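(* Let $\mathfrak R$ and $\mathfrak S$ be complete, separated two-sided linear topological rings with countable bases of neighborhoods of zero, and let $\mathfrak f\colon\mathfrak R\to\mathfrak S$ be a strongly right taut continuous ring map. Let $\mathfrak P$ be a separated left $\mathfrak R$-contramodule. Then the left $\mathfrak S$-module $\operatorname{Hom}^{\mathfrak R}(\mathfrak S,\mathfrak P)$ carries a naturally defined (functorial in $\mathfrak P$) separated left $\mathfrak S$-contramodule structure from which its left $\mathfrak S$-module structure arises. The functor $\mathfrak f^{\text{\textexclamdown}}\colon\mathfrak R\text{-}\mathsf{Separ}\to\mathfrak S\text{-}\mathsf{Separ}$, $\mathfrak P\longmapsto\operatorname{Hom}^{\mathfrak R}(\mathfrak S,\mathfrak P)$, is right adjoint to the functor of restriction of scalars $\mathfrak f_\sharp\colon\mathfrak S\text{-}\mathsf{Separ}\to\mathfrak R\text{-}\mathsf{Separ}$. The adjunction counit $\mathfrak f_\sharp\mathfrak f^{\text{\textexclamdown}}\to\mathrm{Id}$ is the map $\operatorname{Hom}^{\mathfrak R}(\mathfrak S,\mathfrak P)\to\operatorname{Hom}^{\mathfrak R}(\mathfrak R,\mathfrak P)\simeq\mathfrak P$ induced by the left $\mathfrak R$-contramodule morphism $\mathfrak f\colon\mathfrak R\to\mathfrak S$.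
   Context: All rings are associative and unital, and ring maps are unital ring homomorphisms. A topological ring is two-sided linear if open two-sided ideals form a base of neighborhoods of zero; it is complete and separated if the natural map to the projective limit of its quotients by all open subgroups is bijective. A ring map $\mathfrak f\colon\mathfrak R\to\mathfrak S$ of two-sided linear topological rings is strongly right taut if those open two-sided ideals $\mathfrak I\subset\mathfrak R$ for which the closure in $\mathfrak S$ of the right ideal $\mathfrak f(\mathfrak I)\mathfrak S$ generated by $\mathfrak f(\mathfrak I)$ is an open two-sided ideal of $\mathfrak S$ form a base of neighborhoods of zero in $\mathfrak R$. Contramodules. For a set $X$, let $\mathfrak R[[X]]$ be the set of all infinite formal linear combinations $\sum_{x\in X}r_xx$ whose coefficient families $(r_x\in\mathfrak R)_{x\in X}$ converge to zero (for every open subgroup $\mathfrak U\subset\mathfrak R$, $r_x\in\mathfrak U$ for all but finitely many $x$). A map $g\colon X\to Y$ induces $\mathfrak R[[g]]\colon\sum_x r_xx\mapsto\sum_y\bigl(\sum_{g(x)=y}r_x\bigr)y$, where infinite sums in $\mathfrak R$ are limits of finite partial sums. The functor $\mathfrak R[[-]]$ is a monad on sets with unit $\epsilon_X\colon x\mapsto 1\cdot x$ and multiplication $\phi_X\colon\mathfrak R[[\mathfrak R[[X]]]]\to\mathfrak R[[X]]$ given by opening parentheses. A left $\mathfrak R$-contramodule is a module (algebra) over this monad, i.e. a set $\mathfrak P$ with a map $\pi_{\mathfrak P}\colon\mathfrak R[[\mathfrak P]]\to\mathfrak P$ satisfying $\pi_{\mathfrak P}\epsilon_{\mathfrak P}=\mathrm{id}$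 and $\pi_{\mathfrak P}\circ\mathfrak R[[\pi_{\mathfrak P}]]=\pi_{\mathfrak P}\circ\phi_{\mathfrak P}$. These form an abelian category $\mathfrak R\text{-}\mathsf{Contra}$ with Hom groups denoted $\operatorname{Hom}^{\mathfrak R}(-,-)$. Restricting $\pi_{\mathfrak P}$ to finite linear combinations gives the forgetful functor to left $\mathfrak R$-modules. For an open right ideal $\mathfrak I\subset\mathfrak R$, $\mathfrak I\rightthreetimes\mathfrak P\subset\mathfrak P$ is the image under $\pi_{\mathfrak P}$ of the set of those elements of $\mathfrak R[[\mathfrak P]]$ whose coefficients all lie in $\mathfrak I$. The contramodule $\mathfrak P$ is separated if $\bigcap_{\mathfrak I}(\mathfrak I\rightthreetimes\mathfrak P)=0$ (over all open right ideals). $\mathfrak R\text{-}\mathsf{Separ}\subset\mathfrak R\text{-}\mathsf{Contra}$ is the full subcategory of separated left contramodules. Restriction of scalars. A continuous $\mathfrak f$ induces maps $\mathfrak R[[X]]\to\mathfrak S[[X]]$; precomposing $\pi_{\mathfrak Q}\colon\mathfrak S[[\mathfrak Q]]\to\mathfrak Q$ with $\mathfrak R[[\mathfrak Q]]\to\mathfrak S[[\mathfrak Q]]$ defines $\mathfrak f_\sharp\colon\mathfrak S\text{-}\mathsf{Contra}\to\mathfrak R\text{-}\mathsf{Contra}$, which takes separated contramodules to separated ones. The ring $\mathfrak S$ is a left $\mathfrak S$-contramodule (free with one generator), hence via $\mathfrak f_\sharp$ a left $\mathfrak R$-contramodule; right multiplications by elements of $\mathfrak S$ are endomorphisms of this contramodule,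 so $\operatorname{Hom}^{\mathfrak R}(\mathfrak S,\mathfrak P)$ is a left $\mathfrak S$-module via $(sh)(t)=h(ts)$. The isomorphism $\operatorname{Hom}^{\mathfrak R}(\mathfrak R,\mathfrak P)\simeq\mathfrak P$ is $h\mapsto h(1)$. *)

(* Defs.v *)
From HB Require Import structures.
From mathcomp Require Import all_boot all_algebra finmap.
From mathcomp Require Import all_classical topology normedtype.
From mathcomp Require Import summability.

Set Implicit Arguments.
Unset Strict Implicit.
Unset Printing Implicit Defensive.

Import GRing.Theory.

Local Open Scope classical_set_scope.
Local Open Scope ring_scope.

HB.mixin Record TopologicalZmodule_isTopologicalRing R
    & TopologicalZmodule R & GRing.PzRing R := {
  mul_continuous : continuous (fun x : R * R => x.1 * x.2)
}.

#[short(type="topologicalRingType")]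
HB.structure Definition TopologicalRing :=
  {R of TopologicalZmodule R & GRing.PzRing R
      & TopologicalZmodule_isTopologicalRing R}.

Section IdealsAndTopology.
Variable R : topologicalRingType.
Implicit Type I : set R.

Definition subgroup I := I 0 /\ forall x y, I x -> I y -> I (x - y).
Definition right_ideal I := subgroup I /\ forall x r, I x -> I (x * r).
Definition two_sided_ideal I :=
  right_ideal I /\ forall r x, I x -> I (r * x).

Definition nbhs0_base (B : set_system R) := nbhs (0 : R) = filter_from B id.

Definition countable_nbhs0_base :=
  exists2 B : set_system R, countable B & nbhs0_base B.

Definition two_sided_linear :=
  nbhs0_base [set I | open I /\ two_sided_ideal I].

Record open_subgroup := OpenSubgroup {
  osub :> set R;
  osub_open : open osub;
  osub_subgroup : subgroup osub
}.

Definition coset (U : set R) (x : R) : set R := [set y | U (y - x)].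

(* Points of the limit of the quotients R / U: a choice of a coset of every
   open subgroup U; for U contained in V, the transition map sends a coset of U
   to the coset of V that contains it. *)
Record proj_limit := ProjLimit {
  plim_coset :> open_subgroup -> set R;
  plim_cosetP : forall U, exists x, plim_coset U = coset U x;
  plim_compat : forall U V : open_subgroup,
    U `<=` V -> plim_coset U `<=` plim_coset V
}.

Lemma coset_compat x (U V : open_subgroup) :
  U `<=` V -> coset U x `<=` coset V x.
Proof. by move=> UV y; apply: UV. Qed.

Definition to_proj_limit (x : R) : proj_limit :=
  @ProjLimit (fun U => coset U x) (fun U => ex_intro _ x erefl)
    (@coset_compat x).

Definition complete_separated := bijective to_proj_limit.

End IdealsAndTopology.

Definition strongly_right_taut (R S : topologicalRingType) (f : R -> S) :=
  nbhs0_base [set I : set R |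
    let J := closure (smallest (@right_ideal S) (f @` I)) in
    [/\ open I, two_sided_ideal I, open J & two_sided_ideal J]].

(* csl: complete, separated, two-sided linear *)
HB.mixin Record TopologicalRing_isCSLinear R & TopologicalRing R := {
  two_sided_linear_subproof : two_sided_linear R;
  complete_separated_subproof : complete_separated R
}.

#[short(type="cslRingType")]
HB.structure Definition CSLinearRing :=
  {R of TopologicalRing R & TopologicalRing_isCSLinear R}.

Section CSLinearRingTheory.
Variable R : cslRingType.

Lemma cslring_linear : two_sided_linear R.
Proof. exact: two_sided_linear_subproof. Qed.

Lemma cslring_complete : complete_separated R.
Proof. exact: complete_separated_subproof. Qed.

Lemma subgroupN (U : set R) x : subgroup U -> U x -> U (- x).
Proof. by move=> [U0 UB] Ux; rewrite -[- x]add0r; apply: UB. Qed.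

Lemma subgroupD (U : set R) x y : subgroup U -> U x -> U y -> U (x + y).
Proof. by move=> gU Ux Uy; rewrite -[y]opprK; apply: gU.2 => //; apply: subgroupN. Qed.

Lemma subgroup_sum (U : set R) (I : Type) (s : seq I) (P : pred I) (F : I -> R) :
  subgroup U -> (forall i, P i -> U (F i)) -> U (\sum_(i <- s | P i) F i).
Proof.
by move=> gU UF; apply: big_ind => //; [exact: gU.1 | move=> *; apply: subgroupD].
Qed.

Lemma open_ideal_base (N : set R) : nbhs 0 N ->
  exists I : set R, [/\ open I, two_sided_ideal I & I `<=` N].
Proof. by rewrite cslring_linear => -[I [oI iI] IN]; exists I. Qed.

Lemma open_subgroup_nbhs (U : open_subgroup R) : nbhs 0 (U : set R).
Proof. by apply: open_nbhs_nbhs; split; [exact: osub_open|exact: (osub_subgroup U).1]. Qed.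

Definition ideal_osub (I : set R) (oI : open I) (iI : two_sided_ideal I) :=
  OpenSubgroup oI iI.1.1.

Lemma nbhs_shift (x : R) (N : set R) : nbhs 0 N -> nbhs x [set y | N (y - x)].
Proof.
move=> N0; have /(_ (x, x)) := @sub_continuous R; rewrite /continuous_at /= subrr.
move=> /(_ _ N0) [[A B]] /= [xA xB] AB.
apply: filterS xA => y Ay; apply: (AB (y, x)); split => //=.
exact: nbhs_singleton.
Qed.

Lemma nbhs_unshift (x : R) (N : set R) : nbhs x N -> nbhs 0 [set y | N (x + y)].
Proof.
move=> Nx; have /(_ (x, 0)) := @add_continuous R; rewrite /continuous_at /= addr0.
move=> /(_ _ Nx) [[A B]] /= [xA xB] AB.
apply: filterS xB => y By; apply: (AB (x, y)); split => //=.
exact: nbhs_singleton.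
Qed.

Lemma proj_limit_eq (p q : proj_limit R) :
  plim_coset p = plim_coset q -> p = q.
Proof.
case: p q => [c a b] [c' a' b'] /= E; move: a b; rewrite E => a b.
by rewrite (Prop_irrelevance a a') (Prop_irrelevance b b').
Qed.

Lemma separated_eq (x y : R) :
  (forall I, open I -> two_sided_ideal I -> I (x - y)) -> x = y.
Proof.
move=> xy; apply: (bij_inj cslring_complete).
have E (U : open_subgroup R) : coset U x = coset U y.
  have [I [oI iI IU]] := open_ideal_base (open_subgroup_nbhs U).
  have Uxy : osub U (x - y) := IU _ (xy I oI iI).
  apply/seteqP; split => z; rewrite /coset /= => Uz.
    by rewrite -(subrKA x); apply: subgroupD => //; exact: osub_subgroup.
  rewrite -(subrKA y); apply: subgroupD => //; first exact: osub_subgroup.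
  by rewrite -opprB; apply: subgroupN => //; exact: osub_subgroup.
by apply: proj_limit_eq; apply/funext.
Qed.

End CSLinearRingTheory.

Section Summation.
Variable R : cslRingType.

Definition converges_to_zero (X : Type) (r : X -> R) :=
  forall U : open_subgroup R, finite_set [set x | ~ osub U (r x)].

Definition finite_partial_sum (X : Type) (r : X -> R) (A : {fset {classic X}}) : R :=
  \sum_(x <- A) r x.

(* The limit of the finite partial sums (0 if they do not converge); limits
   are unique because the topology is separated. *)
Definition infinite_sum (X : Type) (r : X -> R) : R :=
  xget 0 [set s : R | finite_partial_sum r @ totally --> s].

Lemma czero_ideal (X : Type) (r : X -> R) :
  (forall I, open I -> two_sided_ideal I -> exists A : {fset {classic X}},
     forall x : {classic X}, x \notin A -> I (r x)) ->
  converges_to_zero r.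
Proof.
move=> H U; have [I [oI iI IU]] := open_ideal_base (open_subgroup_nbhs U).
have [A AP] := H I oI iI.
apply: sub_finite_set (finite_fset A) => x /= nU.
by apply: contrapT => /negP xA; apply: nU; apply: IU; apply: AP.
Qed.

Lemma czero_fset (X : Type) (r : X -> R) (U : open_subgroup R) :
  converges_to_zero r ->
  exists A : {fset {classic X}}, forall x : {classic X}, x \notin A -> osub U (r x).
Proof.
move=> /(_ U) fA; exists (@fset_set {classic X} [set x | ~ osub U (r x)]) => x.
rewrite in_fset_set // => /negP; rewrite inE /= => nU.
exact: contrapT.
Qed.

Lemma partial_sum_diff (X : Type) (r : X -> R) (U : set R)
    (A B : {fset {classic X}}) : subgroup U ->
  (forall x : {classic X}, x \notin A -> U (r x)) -> (A `<=` B)%fset ->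
  U (finite_partial_sum r B - finite_partial_sum r A).
Proof.
move=> gU UA /fsubsetP AB; rewrite /finite_partial_sum (bigID (mem A)) /=.
have -> : \sum_(x <- B | x \in A) r x = \sum_(x <- A) r x.
  rewrite -big_filter; apply: perm_big; apply: uniq_perm.
  - by rewrite filter_uniq ?fset_uniq.
  - exact: fset_uniq.
  move=> x; rewrite mem_filter.
  by apply/andP/idP => [[] //|xA]; split => //; apply: AB.
by rewrite addrC addrK; apply: subgroup_sum.
Qed.

Lemma partial_sum_cvg (X : Type) (r : X -> R) : converges_to_zero r ->
  exists s : R, finite_partial_sum r @ totally --> s.
Proof.
move=> rz; pose A (U : open_subgroup R) := projT1 (cid (czero_fset U rz)).
have AP U (x : {classic X}) : x \notin A U -> osub U (r x).
  by move: x; rewrite /A; case: cid.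
pose c (U : open_subgroup R) := coset U (finite_partial_sum r (A U)).
have cc (U V : open_subgroup R) : U `<=` V -> c U `<=` c V.
  move=> UV y Uy; rewrite /c /coset /=.
  have gV := osub_subgroup V.
  set a := finite_partial_sum r (A U `|` A V)%fset.
  have H1 : osub V (a - finite_partial_sum r (A U)).
    by apply: UV; apply: partial_sum_diff (@AP U) _; [exact: osub_subgroup|exact: fsubsetUl].
  have H2 : osub V (a - finite_partial_sum r (A V)).
    by apply: partial_sum_diff (@AP V) _ => //; exact: fsubsetUr.
  have H3 : osub V (y - finite_partial_sum r (A U)) by apply: UV.
  rewrite -(subrKA a); apply: subgroupD => //.
  have -> : y - a = (y - finite_partial_sum r (A U)) - (a - finite_partial_sum r (A U)).
    by rewrite opprB addrA subrK.
  exact: gV.2.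
have [g gK Kg] := @cslring_complete R.
pose l := @ProjLimit R c (fun U => ex_intro _ _ erefl) cc.
exists (g l) => N Ng.
have El U : c U = coset U (g l).
  by have /(congr1 (fun p : proj_limit R => p U)) := Kg l.
have [I [oI iI IN]] := open_ideal_base (nbhs_unshift Ng).
pose U := ideal_osub oI iI.
exists (A U) => // B /= AB.
have -> : finite_partial_sum r B = g l + (finite_partial_sum r B - g l).
  by rewrite addrC subrK.
apply: IN; rewrite -(subrKA (finite_partial_sum r (A U))).
apply: (subgroupD iI.1.1); first exact: (partial_sum_diff iI.1.1 (@AP U)).
have : c U (g l) by rewrite El /coset /= subrr; exact: iI.1.1.1.
by rewrite /c /coset /= => /(subgroupN iI.1.1); rewrite opprB.
Qed.

Lemma infinite_sumP (X : Type) (r : X -> R) (U : open_subgroup R)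
    (A : {fset {classic X}}) : converges_to_zero r ->
  (forall x : {classic X}, x \notin A -> osub U (r x)) ->
  osub U (infinite_sum r - finite_partial_sum r A).
Proof.
move=> rz UA; have gU := osub_subgroup U.
rewrite /infinite_sum; case: xgetP => [s _ /= cs|none]; last first.
  by have [s cs] := partial_sum_cvg rz; have := none s.
have [B _ /= /(_ (A `|` B)%fset (fsubsetUr _ _)) /= H] :=
  cs _ (nbhs_shift s (open_subgroup_nbhs U)).
rewrite -(subrKA (finite_partial_sum r (A `|` B)%fset)); apply: subgroupD => //.
  by rewrite -opprB; apply: subgroupN.
by apply: partial_sum_diff UA _ => //; exact: fsubsetUl.
Qed.

Lemma infinite_sum_in (X : Type) (r : X -> R) (U : open_subgroup R) :
  converges_to_zero r -> (forall x, osub U (r x)) -> osub U (infinite_sum r).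
Proof.
move=> rz Ur.
have := @infinite_sumP _ r U fset0 rz (fun x _ => Ur x).
by rewrite /finite_partial_sum big_nil subr0.
Qed.

Lemma eq_infinite_sum (X : Type) (r r' : X -> R) :
  r =1 r' -> infinite_sum r = infinite_sum r'.
Proof. by move=> /funext ->. Qed.

Lemma infinite_sum_eq (X : Type) (r : X -> R) (s : R) : converges_to_zero r ->
  (forall I, open I -> two_sided_ideal I -> exists A : {fset {classic X}},
     (forall x : {classic X}, x \notin A -> I (r x)) /\
     I (s - finite_partial_sum r A)) ->
  infinite_sum r = s.
Proof.
move=> rz H; apply: separated_eq => I oI iI.
have [A [AI As]] := H I oI iI.
have Ar := @infinite_sumP _ r (ideal_osub oI iI) A rz AI.
rewrite -(subrKA (finite_partial_sum r A)); apply: (subgroupD iI.1.1) => //.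
by rewrite -opprB; apply: subgroupN => //; exact: iI.1.1.
Qed.

Lemma czeroD (X : Type) (r r' : X -> R) : converges_to_zero r ->
  converges_to_zero r' -> converges_to_zero (fun x => r x + r' x).
Proof.
move=> rz rz'; apply: czero_ideal => I oI iI.
have [A AP] := czero_fset (ideal_osub oI iI) rz.
have [B BP] := czero_fset (ideal_osub oI iI) rz'.
exists (A `|` B)%fset => x; rewrite in_fsetU negb_or => /andP[xA xB].
by apply: (subgroupD iI.1.1); [apply: AP|apply: BP].
Qed.

Lemma czeroMl (X : Type) (k r : X -> R) : converges_to_zero r ->
  converges_to_zero (fun x => k x * r x).
Proof.
move=> rz; apply: czero_ideal => I oI iI.
have [A AP] := czero_fset (ideal_osub oI iI) rz.
by exists A => x xA; apply: iI.2; apply: AP.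
Qed.

Lemma czeroMr (X : Type) (k r : X -> R) : converges_to_zero r ->
  converges_to_zero (fun x => r x * k x).
Proof.
move=> rz; apply: czero_ideal => I oI iI.
have [A AP] := czero_fset (ideal_osub oI iI) rz.
by exists A => x xA; apply: iI.1.2; apply: AP.
Qed.

Lemma czeroN (X : Type) (r : X -> R) : converges_to_zero r ->
  converges_to_zero (fun x => - r x).
Proof.
move=> /(czeroMl (fun=> -1)) H; rewrite (_ : (fun _ => _) = fun x => -1 * r x) //.
by apply/funext => x; rewrite mulN1r.
Qed.

Lemma czero0 (X : Type) : converges_to_zero (fun _ : X => 0 : R).
Proof.
by apply: czero_ideal => I oI iI; exists fset0 => x _; exact: iI.1.1.1.
Qed.

Lemma czero_if (X : Type) (b : X -> bool) (r : X -> R) : converges_to_zero r ->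
  converges_to_zero (fun x => if b x then r x else 0).
Proof.
move=> /(czeroMr (fun x => if b x then 1 else 0)) H.
rewrite (_ : (fun _ => _) = fun x => r x * if b x then 1 else 0) //.
by apply/funext => x; case: (b x); rewrite ?mulr1 ?mulr0.
Qed.

Lemma infinite_sumD (X : Type) (r r' : X -> R) : converges_to_zero r ->
  converges_to_zero r' ->
  infinite_sum (fun x => r x + r' x) = infinite_sum r + infinite_sum r'.
Proof.
move=> rz rz'; apply: infinite_sum_eq => [|I oI iI]; first exact: czeroD.
have [A AP] := czero_fset (ideal_osub oI iI) rz.
have [B BP] := czero_fset (ideal_osub oI iI) rz'.
have gI := iI.1.1.
exists (A `|` B)%fset.
have AP' (x : {classic X}) : x \notin (A `|` B)%fset -> I (r x).
  by rewrite in_fsetU negb_or => /andP[xA xB]; apply: AP.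
have BP' (x : {classic X}) : x \notin (A `|` B)%fset -> I (r' x).
  by rewrite in_fsetU negb_or => /andP[xA xB]; apply: BP.
split=> [x xAB|]; first by apply: (subgroupD gI); [apply: AP'|apply: BP'].
rewrite /finite_partial_sum big_split /= opprD addrACA.
by apply: (subgroupD gI); apply: (@infinite_sumP _ _ (ideal_osub oI iI)).
Qed.

Lemma infinite_sumMl (X : Type) (k : R) (r : X -> R) : converges_to_zero r ->
  infinite_sum (fun x => k * r x) = k * infinite_sum r.
Proof.
move=> rz; apply: infinite_sum_eq => [|I oI iI].
  by have := czeroMl (fun=> k) rz.
have [A AP] := czero_fset (ideal_osub oI iI) rz.
exists A; split=> [x xA|]; first by apply: iI.2; apply: AP.
rewrite /finite_partial_sum -mulr_sumr -mulrBr; apply: iI.2.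
exact: (@infinite_sumP _ _ (ideal_osub oI iI)).
Qed.

Lemma infinite_sumMr (X : Type) (k : R) (r : X -> R) : converges_to_zero r ->
  infinite_sum (fun x => r x * k) = infinite_sum r * k.
Proof.
move=> rz; apply: infinite_sum_eq => [|I oI iI].
  by have := czeroMr (fun=> k) rz.
have [A AP] := czero_fset (ideal_osub oI iI) rz.
exists A; split=> [x xA|]; first by apply: iI.1.2; apply: AP.
rewrite /finite_partial_sum -mulr_suml -mulrBl; apply: iI.1.2.
exact: (@infinite_sumP _ _ (ideal_osub oI iI)).
Qed.

Lemma infinite_sum_single (X : Type) (r : X -> R) (x0 : X) :
  (forall x, x <> x0 -> r x = 0) -> infinite_sum r = r x0.
Proof.
move=> r0.
have rI (I : set R) : two_sided_ideal I ->
    forall x : {classic X}, x \notin [fset (x0 : {classic X})]%fset -> I (r x).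
  move=> iI x; rewrite in_fset1 => /eqP nx; rewrite r0 //; exact: iI.1.1.1.
have rz : converges_to_zero r.
  apply: czero_ideal => I oI iI; exists [fset (x0 : {classic X})]%fset.
  exact: rI.
apply: infinite_sum_eq rz _ => I oI iI; exists [fset (x0 : {classic X})]%fset.
split; first exact: rI.
rewrite /finite_partial_sum big_seq_fset1 subrr; exact: iI.1.1.1.
Qed.

Definition jointly_czero (X Y : Type) (F : X -> Y -> R) :=
  forall I : set R, open I -> two_sided_ideal I ->
  exists (A : {fset {classic X}}) (B : {fset {classic Y}}),
    (forall (x : {classic X}) y, x \notin A -> I (F x y)) /\
    (forall x (y : {classic Y}), y \notin B -> I (F x y)).

Lemma jointly_czeroC (X Y : Type) (F : X -> Y -> R) :
  jointly_czero F -> jointly_czero (fun y x => F x y).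
Proof.
move=> Fz I oI iI; have [A [B [AP BP]]] := Fz I oI iI.
by exists B, A; split=> [y x|y x]; [apply: BP|apply: AP].
Qed.

Lemma jointly_czero_r (X Y : Type) (F : X -> Y -> R) x :
  jointly_czero F -> converges_to_zero (F x).
Proof.
move=> Fz; apply: czero_ideal => I oI iI.
by have [A [B [AP BP]]] := Fz I oI iI; exists B => y; apply: BP.
Qed.

Lemma jointly_czero_l (X Y : Type) (F : X -> Y -> R) y :
  jointly_czero F -> converges_to_zero (F ^~ y).
Proof. by move=> /jointly_czeroC/(@jointly_czero_r _ _ _ y). Qed.

Lemma jointly_czero_sum (X Y : Type) (F : X -> Y -> R) :
  jointly_czero F -> converges_to_zero (fun x => infinite_sum (F x)).
Proof.
move=> Fz; apply: czero_ideal => I oI iI.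
have [A [B [AP BP]]] := Fz I oI iI; exists A => x xA.
apply: (@infinite_sum_in _ _ (ideal_osub oI iI)); first exact: jointly_czero_r.
by move=> y; apply: AP.
Qed.

Lemma infinite_sum_exchange (X Y : Type) (F : X -> Y -> R) : jointly_czero F ->
  infinite_sum (fun x => infinite_sum (F x)) =
  infinite_sum (fun y => infinite_sum (F ^~ y)).
Proof.
move=> Fz; apply: separated_eq => I oI iI.
have [A [B [AP BP]]] := Fz I oI iI.
have gI := iI.1.1.
have H (Z T : Type) (G : Z -> T -> R) (C : {fset {classic Z}})
    (D : {fset {classic T}}) : jointly_czero G ->
    (forall (x : {classic Z}) y, x \notin C -> I (G x y)) ->
    (forall x (y : {classic T}), y \notin D -> I (G x y)) ->
    I (infinite_sum (fun x => infinite_sum (G x)) -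
       \sum_(x <- C) \sum_(y <- D) G x y).
  move=> Gz CP DP.
  rewrite -(subrKA (\sum_(x <- C) infinite_sum (G x))).
  apply: (subgroupD gI).
    apply: (@infinite_sumP _ _ (ideal_osub oI iI)) => [|x xC].
      exact: jointly_czero_sum.
    apply: (@infinite_sum_in _ _ (ideal_osub oI iI)).
      exact: jointly_czero_r.
    by move=> y; apply: CP.
  rewrite -sumrB; refine (@subgroup_sum R I {classic Z} C xpredT _ gI _) => x _.
  apply: (@infinite_sumP _ _ (ideal_osub oI iI)); first exact: jointly_czero_r.
  by move=> y; apply: DP.
have H1 := H _ _ F A B Fz AP BP.
have H2 := H _ _ _ B A (jointly_czeroC Fz) (fun y x => BP x y) (fun y x => AP x y).
rewrite -(subrKA (\sum_(x <- A) \sum_(y <- B) F x y)).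
apply: (subgroupD gI H1); rewrite -opprB; apply: subgroupN => //.
by rewrite exchange_big.
Qed.

End Summation.

Section FormalCombinations.
Variable R : cslRingType.

Record lincomb (X : Type) := LinComb {
  coef :> X -> R;
  coef_czero : converges_to_zero coef
}.

Lemma lincomb_eq (X : Type) (a b : lincomb X) : a =1 b -> a = b.
Proof.
case: a b => [a az] [b bz] /= /funext ab; rewrite ab in az *.
by rewrite (Prop_irrelevance az bz).
Qed.

HB.instance Definition _ (X : Type) := gen_eqMixin (lincomb X).
HB.instance Definition _ (X : Type) := gen_choiceMixin (lincomb X).

Section Module.
Variable X : Type.
Implicit Types a b : lincomb X.

Definition lc_zero : lincomb X := LinComb (@czero0 R X).
Definition lc_opp a : lincomb X := LinComb (czeroN (coef_czero a)).
Definition lc_add a b : lincomb X :=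
  LinComb (czeroD (coef_czero a) (coef_czero b)).
Definition lc_scale (r : R) a : lincomb X :=
  LinComb (czeroMl (fun=> r) (coef_czero a)).

Fact lc_addA : associative lc_add.
Proof. by move=> a b c; apply: lincomb_eq => x /=; rewrite addrA. Qed.
Fact lc_addC : commutative lc_add.
Proof. by move=> a b; apply: lincomb_eq => x /=; rewrite addrC. Qed.
Fact lc_add0 : left_id lc_zero lc_add.
Proof. by move=> a; apply: lincomb_eq => x /=; rewrite add0r. Qed.
Fact lc_addN : left_inverse lc_zero lc_opp lc_add.
Proof. by move=> a; apply: lincomb_eq => x /=; rewrite addNr. Qed.
HB.instance Definition _ :=
  GRing.isZmodule.Build (lincomb X) lc_addA lc_addC lc_add0 lc_addN.

Fact lc_scaleA r s a : lc_scale r (lc_scale s a) = lc_scale (r * s) a.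
Proof. by apply: lincomb_eq => x /=; rewrite mulrA. Qed.
Fact lc_scale1 : left_id 1 lc_scale.
Proof. by move=> a; apply: lincomb_eq => x /=; rewrite mul1r. Qed.
Fact lc_scaleDr : right_distributive lc_scale +%R.
Proof. by move=> r a b; apply: lincomb_eq => x /=; rewrite mulrDr. Qed.
Fact lc_scaleDl a : {morph lc_scale ^~ a : r s / r + s}.
Proof. by move=> r s; apply: lincomb_eq => x /=; rewrite mulrDl. Qed.
HB.instance Definition _ := GRing.Zmodule_isLmodule.Build R (lincomb X)
  lc_scaleA lc_scale1 lc_scaleDr lc_scaleDl.

Lemma lc_single_czero (r : R) (x : X) :
  converges_to_zero (fun y => if `[< y = x >] then r else 0).
Proof.
apply: czero_ideal => I oI iI; exists [fset (x : {classic X})]%fset => y.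
rewrite in_fset1 => /eqP nxy; case: asboolP => // _.
exact: iI.1.1.1.
Qed.

Definition lc_single (r : R) (x : X) : lincomb X := LinComb (lc_single_czero r x).

End Module.

Definition lc_unit (X : Type) (x : X) : lincomb X := lc_single 1 x.

Lemma jointly_czero_lc (X Y : Type) (a : lincomb X) (k : X -> Y -> R) :
  (forall x, converges_to_zero (k x)) -> jointly_czero (fun x y => a x * k x y).
Proof.
move=> kz I oI iI.
have [A AP] := czero_fset (ideal_osub oI iI) (coef_czero a).
have fB : finite_set (\bigcup_(x in [set` A]) [set y | ~ I (k x y)]).
  by apply: bigcup_finite => [|x _]; [exact: finite_fset|exact: (kz x (ideal_osub oI iI))].
exists A, (@fset_set {classic Y} (\bigcup_(x in [set` A]) [set y | ~ I (k x y)])).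
split=> [x y xA|x y]; first by apply: iI.1.2; apply: AP.
rewrite in_fset_set // => /negP; rewrite inE /= => nB.
have [xA|xA] := boolP ((x : {classic X}) \in A); last by apply: iI.1.2; apply: AP.
apply: iI.2; apply: contrapT => nI; apply: nB; by exists x.
Qed.

Definition lc_eval (X : Type) (a : lincomb X) (k : X -> R) : R :=
  infinite_sum (fun x => a x * k x).

Definition lc_bind_coef (X Y : Type) (a : lincomb X) (k : X -> lincomb Y) (y : Y) :=
  lc_eval a (k ^~ y).

Lemma lc_bind_czero (X Y : Type) (a : lincomb X) (k : X -> lincomb Y) :
  converges_to_zero (lc_bind_coef a k).
Proof.
have := jointly_czero_lc a (fun x => coef_czero (k x)).
by move=> /jointly_czeroC /jointly_czero_sum.
Qed.

Definition lc_bind (X Y : Type) (a : lincomb X) (k : X -> lincomb Y) : lincomb Y :=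
  LinComb (lc_bind_czero a k).

Lemma lc_map_coefE (X Y : Type) (g : X -> Y) (a : lincomb X) (y : Y) :
  infinite_sum (fun x => if `[< g x = y >] then a x else 0) =
  lc_bind a (@lc_unit Y \o g) y.
Proof.
apply: eq_infinite_sum => x /=; do 2 case: asboolP => //.
- by rewrite mulr1.
- by move=> H /esym.
- by move=> /esym.
- by rewrite mulr0.
Qed.

Lemma lc_map_czero (X Y : Type) (g : X -> Y) (a : lincomb X) :
  converges_to_zero
    (fun y => infinite_sum (fun x => if `[< g x = y >] then a x else 0)).
Proof. rewrite (funext (lc_map_coefE g a)); exact: coef_czero. Qed.

Definition lc_map (X Y : Type) (g : X -> Y) (a : lincomb X) : lincomb Y :=
  LinComb (lc_map_czero g a).

Lemma lc_mul_czero (X : Type) (a : lincomb (lincomb X)) :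
  converges_to_zero (fun x => infinite_sum (fun b : lincomb X => a b * b x)).
Proof. exact: (lc_bind_czero a id). Qed.

Definition lc_mul (X : Type) (a : lincomb (lincomb X)) : lincomb X :=
  LinComb (lc_mul_czero a).

Lemma lc_mapE (X Y : Type) (g : X -> Y) a : lc_map g a = lc_bind a (@lc_unit Y \o g).
Proof. by apply: lincomb_eq => y; apply: lc_map_coefE. Qed.

Lemma lc_mulE (X : Type) (a : lincomb (lincomb X)) : lc_mul a = lc_bind a id.
Proof. by apply: lincomb_eq. Qed.

Lemma lc_eval_bind (X Y : Type) (a : lincomb X) (k : X -> lincomb Y) (l : Y -> R) :
  lc_eval (lc_bind a k) l = lc_eval a (fun x => lc_eval (k x) l).
Proof.
have kz x : converges_to_zero (fun y => k x y * l y).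
  exact: czeroMr (coef_czero (k x)).
transitivity (infinite_sum (fun y => infinite_sum (fun x => a x * (k x y * l y)))).
  apply: eq_infinite_sum => y /=; rewrite /lc_bind_coef /lc_eval -infinite_sumMr.
    by apply: eq_infinite_sum => x; rewrite mulrA.
  exact: (czeroMr _ (coef_czero a)).
rewrite (infinite_sum_exchange (jointly_czeroC (jointly_czero_lc a kz))).
apply: eq_infinite_sum => x; rewrite infinite_sumMl //; exact: kz.
Qed.

Lemma lc_eval_single (X : Type) (r : R) (x : X) (k : X -> R) :
  lc_eval (lc_single r x) k = r * k x.
Proof.
have E y : y <> x -> lc_single r x y * k y = 0.
  by move=> /= nyx; case: asboolP => // _; rewrite mul0r.
by rewrite /lc_eval (infinite_sum_single E) /=; case: asboolP.
Qed.

Lemma lc_eval_unit (X : Type) (x : X) (k : X -> R) : lc_eval (lc_unit x) k = k x.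
Proof. by rewrite lc_eval_single mul1r. Qed.

Lemma lc_evalDl (X : Type) (a b : lincomb X) (k : X -> R) :
  lc_eval (a + b) k = lc_eval a k + lc_eval b k.
Proof.
rewrite /lc_eval -infinite_sumD; last 2 first.
- exact: (czeroMr _ (coef_czero a)).
- exact: (czeroMr _ (coef_czero b)).
by apply: eq_infinite_sum => x /=; rewrite mulrDl.
Qed.

Lemma lc_evalZl (X : Type) (r : R) (a : lincomb X) (k : X -> R) :
  lc_eval (r *: a) k = r * lc_eval a k.
Proof.
rewrite /lc_eval -infinite_sumMl; last exact: (czeroMr _ (coef_czero a)).
by apply: eq_infinite_sum => x /=; rewrite mulrA.
Qed.

Lemma lc_evalDr (X : Type) (a : lincomb X) (k l : X -> R) :
  lc_eval a (fun x => k x + l x) = lc_eval a k + lc_eval a l.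
Proof.
rewrite /lc_eval -infinite_sumD; last 2 first.
- exact: (czeroMr _ (coef_czero a)).
- exact: (czeroMr _ (coef_czero a)).
by apply: eq_infinite_sum => x /=; rewrite mulrDr.
Qed.

Lemma lc_evalMr (X : Type) (a : lincomb X) (k : X -> R) (r : R) :
  lc_eval a (fun x => k x * r) = lc_eval a k * r.
Proof.
rewrite /lc_eval -infinite_sumMr; last exact: (czeroMr _ (coef_czero a)).
by apply: eq_infinite_sum => x /=; rewrite mulrA.
Qed.

Lemma lc_bindA (X Y Z : Type) (a : lincomb X) (k : X -> lincomb Y)
    (l : Y -> lincomb Z) :
  lc_bind (lc_bind a k) l = lc_bind a (fun x => lc_bind (k x) l).
Proof. by apply: lincomb_eq => z; apply: lc_eval_bind. Qed.

Lemma lc_bind_unit (X Y : Type) (x : X) (k : X -> lincomb Y) :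
  lc_bind (lc_unit x) k = k x.
Proof. by apply: lincomb_eq => y; apply: lc_eval_unit. Qed.

Lemma lc_bind_unitr (X : Type) (a : lincomb X) : lc_bind a (@lc_unit X) = a.
Proof.
apply: lincomb_eq => x.
have E y : y <> x -> a y * lc_unit y x = 0.
  by move=> /= nyx; case: asboolP => [/esym //|_]; rewrite mulr0.
rewrite [LHS](infinite_sum_single E) /=.
by case: asboolP => //; rewrite mulr1.
Qed.

Lemma lc_bindDl (X Y : Type) (a b : lincomb X) (k : X -> lincomb Y) :
  lc_bind (a + b) k = lc_bind a k + lc_bind b k.
Proof. by apply: lincomb_eq => y; apply: lc_evalDl. Qed.

Lemma lc_bindZl (X Y : Type) (r : R) (a : lincomb X) (k : X -> lincomb Y) :
  lc_bind (r *: a) k = r *: lc_bind a k.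
Proof. by apply: lincomb_eq => y; apply: lc_evalZl. Qed.

Lemma lc_bindDr (X Y : Type) (a : lincomb X) (k l : X -> lincomb Y) :
  lc_bind a (fun x => k x + l x) = lc_bind a k + lc_bind a l.
Proof. by apply: lincomb_eq => y; apply: lc_evalDr. Qed.

Lemma lc_bindNr (X Y : Type) (a : lincomb X) (k : X -> lincomb Y) :
  lc_bind a (fun x => - k x) = - lc_bind a k.
Proof.
apply: lincomb_eq => y /=; rewrite -mulrN1 /lc_bind_coef -lc_evalMr.
by congr lc_eval; apply/funext => x /=; rewrite mulrN1.
Qed.

Lemma lc_bind0r (X Y : Type) (a : lincomb X) :
  lc_bind a (fun _ => 0 : lincomb Y) = 0.
Proof.
apply: lincomb_eq => y /=; rewrite /lc_bind_coef -(mulr0 (lc_eval a (fun=> 0))).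
by rewrite -lc_evalMr; congr lc_eval; apply/funext => x /=; rewrite mulr0.
Qed.

Lemma lc_singleE (X : Type) (r : R) (x : X) : lc_single r x = r *: lc_unit x.
Proof.
by apply: lincomb_eq => y /=; case: asboolP; rewrite ?mulr1 ?mulr0.
Qed.

Lemma lc_map_unit (X Y : Type) (g : X -> Y) (x : X) :
  lc_map g (lc_unit x) = lc_unit (g x).
Proof. by rewrite lc_mapE lc_bind_unit. Qed.

Lemma lc_map_single (X Y : Type) (g : X -> Y) r (x : X) :
  lc_map g (lc_single r x) = lc_single r (g x).
Proof. by rewrite !lc_singleE lc_mapE lc_bindZl lc_bind_unit. Qed.

Lemma lc_mapD (X Y : Type) (g : X -> Y) (a b : lincomb X) :
  lc_map g (a + b) = lc_map g a + lc_map g b.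
Proof. by rewrite !lc_mapE lc_bindDl. Qed.

Lemma lc_map_id (X : Type) (a : lincomb X) : lc_map id a = a.
Proof. by rewrite lc_mapE -[RHS]lc_bind_unitr. Qed.

Lemma lc_bind_map (X Y Z : Type) (g : X -> Y) (a : lincomb X)
    (k : Y -> lincomb Z) : lc_bind (lc_map g a) k = lc_bind a (k \o g).
Proof.
rewrite lc_mapE lc_bindA; congr lc_bind; apply/funext => x /=.
exact: lc_bind_unit.
Qed.

Lemma lc_eval_map (X Y : Type) (g : X -> Y) (a : lincomb X) (k : Y -> R) :
  lc_eval (lc_map g a) k = lc_eval a (k \o g).
Proof.
rewrite lc_mapE lc_eval_bind; congr lc_eval; apply/funext => x /=.
exact: lc_eval_unit.
Qed.

Lemma lc_map_comp (X Y Z : Type) (g : X -> Y) (h : Y -> Z) (a : lincomb X) :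
  lc_map h (lc_map g a) = lc_map (h \o g) a.
Proof. by rewrite lc_mapE lc_bind_map lc_mapE. Qed.

Lemma lc_mul_map (X Y : Type) (g : X -> lincomb Y) (a : lincomb X) :
  lc_mul (lc_map g a) = lc_bind a g.
Proof. by rewrite lc_mulE lc_bind_map. Qed.

End FormalCombinations.

Section Contramodules.
Variable R : cslRingType.

Record contramodule := Contramodule {
  cm_carrier :> Type;
  cm_act : lincomb R cm_carrier -> cm_carrier;
  cm_unitP : forall p, cm_act (lc_unit R p) = p;
  cm_assocP : forall a : lincomb R (lincomb R cm_carrier),
    cm_act (lc_map cm_act a) = cm_act (lc_mul a)
}.

HB.instance Definition _ (P : contramodule) := gen_eqMixin (cm_carrier P).
HB.instance Definition _ (P : contramodule) := gen_choiceMixin (cm_carrier P).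

(* The underlying module is the restriction of cm_act to finite combinations. *)
Section UnderlyingModule.
Variable P : contramodule.
Implicit Types (p q : P) (r s : R).

Definition cm_zero : P := cm_act 0.
Definition cm_add p q : P := cm_act (lc_unit R p + lc_unit R q).
Definition cm_scale r p : P := cm_act (lc_single r p).
Definition cm_opp p : P := cm_scale (-1) p.

Lemma cm_act_mapD (a b : lincomb R P) : cm_act (a + b) = cm_add (cm_act a) (cm_act b).
Proof.
rewrite /cm_add -!lc_map_unit -lc_mapD cm_assocP lc_mulE lc_bindDl.
by rewrite !lc_bind_unit.
Qed.

Lemma cm_act_mapZ r (a : lincomb R P) : cm_act (r *: a) = cm_scale r (cm_act a).
Proof.
rewrite /cm_scale -lc_map_single cm_assocP lc_mulE lc_singleE lc_bindZl.
by rewrite lc_bind_unit.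
Qed.

Fact cm_addA : associative cm_add.
Proof.
move=> p q s; rewrite -(cm_unitP p) -(cm_unitP q) -(cm_unitP s).
by rewrite -!cm_act_mapD addrA.
Qed.
Fact cm_addC : commutative cm_add.
Proof. by move=> p q; rewrite /cm_add addrC. Qed.
Fact cm_add0 : left_id cm_zero cm_add.
Proof. by move=> p; rewrite -(cm_unitP p) -cm_act_mapD add0r. Qed.
Fact cm_addN : left_inverse cm_zero cm_opp cm_add.
Proof.
move=> p; rewrite /cm_opp -(cm_unitP p) -cm_act_mapZ -cm_act_mapD.
by rewrite scaleN1r addNr.
Qed.
HB.instance Definition _ :=
  GRing.isZmodule.Build (cm_carrier P) cm_addA cm_addC cm_add0 cm_addN.

Fact cm_scaleA r s p : cm_scale r (cm_scale s p) = cm_scale (r * s) p.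
Proof. by rewrite -(cm_unitP p) -!cm_act_mapZ scalerA. Qed.
Fact cm_scale1 : left_id 1 cm_scale.
Proof. by move=> p; rewrite -(cm_unitP p) -!cm_act_mapZ scale1r. Qed.
Fact cm_scaleDr : right_distributive cm_scale +%R.
Proof.
move=> r p q; rewrite -(cm_unitP p) -(cm_unitP q).
by rewrite -[_ + _]cm_act_mapD -!cm_act_mapZ -[RHS]cm_act_mapD scalerDr.
Qed.
Fact cm_scaleDl p : {morph cm_scale ^~ p : r s / r + s}.
Proof.
move=> r s; rewrite -(cm_unitP p) -!cm_act_mapZ scalerDl.
exact: cm_act_mapD.
Qed.
HB.instance Definition _ := GRing.Zmodule_isLmodule.Build R (cm_carrier P)
  cm_scaleA cm_scale1 cm_scaleDr cm_scaleDl.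

Lemma cm_actD (a b : lincomb R P) : cm_act (a + b) = cm_act a + cm_act b.
Proof. exact: cm_act_mapD. Qed.

Lemma cm_actZ r (a : lincomb R P) : cm_act (r *: a) = r *: cm_act a.
Proof. exact: cm_act_mapZ. Qed.

Lemma cm_act0 : cm_act (0 : lincomb R P) = 0.
Proof. by []. Qed.

End UnderlyingModule.

Definition contra_mul (P : contramodule) (I : set R) : set P :=
  @cm_act P @` [set a : lincomb R P | forall p, I (a p)].

Definition separated_contra (P : contramodule) : Prop :=
  \bigcap_(I in [set I : set R | open I /\ right_ideal I]) @contra_mul P I =
  [set 0 : P].

Definition is_contra_hom (P Q : contramodule) (h : P -> Q) :=
  forall a : lincomb R P, h (cm_act a) = cm_act (lc_map h a).

Record contra_hom (P Q : contramodule) := ContraHom {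
  contra_hom_fun :> P -> Q;
  contra_homP : is_contra_hom contra_hom_fun
}.

Lemma contra_hom_eq (P Q : contramodule) (g h : contra_hom P Q) : g =1 h -> g = h.
Proof.
case: g h => [g gP] [h hP] /= /funext gh; rewrite gh in gP *.
by rewrite (Prop_irrelevance gP hP).
Qed.

Lemma contra_id_subproof (P : contramodule) : @is_contra_hom P P id.
Proof. by move=> a; rewrite lc_map_id. Qed.
Definition contra_id (P : contramodule) := ContraHom (@contra_id_subproof P).

Lemma contra_comp_subproof (P Q T : contramodule) (h : contra_hom Q T)
  (g : contra_hom P Q) : is_contra_hom (h \o g).
Proof. by move=> a /=; rewrite contra_homP contra_homP lc_map_comp. Qed.
Definition contra_comp (P Q T : contramodule) (h : contra_hom Q T)
  (g : contra_hom P Q) := ContraHom (contra_comp_subproof h g).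

Lemma contra_homD (P Q : contramodule) (h : contra_hom P Q) p q :
  h (p + q) = h p + h q.
Proof. by rewrite [p + q]/(cm_add p q) contra_homP lc_mapD !lc_map_unit. Qed.

HB.instance Definition _ (P Q : contramodule) := gen_eqMixin (contra_hom P Q).
HB.instance Definition _ (P Q : contramodule) := gen_choiceMixin (contra_hom P Q).

Section HomGroup.
Variables P Q : contramodule.
Implicit Types g h : contra_hom P Q.

Lemma hom_zero_subproof : @is_contra_hom P Q (fun=> 0).
Proof.
move=> a; have -> : lc_map (fun _ : P => 0 : Q) a =
    lc_map (@cm_act Q) (lc_map (fun=> 0) a) by rewrite lc_map_comp; congr lc_map.
by rewrite cm_assocP lc_mul_map lc_bind0r.
Qed.
Definition hom_zero : contra_hom P Q := ContraHom hom_zero_subproof.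

Lemma hom_add_subproof g h : is_contra_hom (fun p => g p + h p).
Proof.
move=> a; rewrite !contra_homP -cm_actD.
have -> : lc_map (fun p => g p + h p) a =
    lc_map (@cm_act Q) (lc_map (fun p => lc_unit R (g p) + lc_unit R (h p)) a).
  by rewrite lc_map_comp; congr lc_map.
by rewrite cm_assocP lc_mul_map lc_bindDr !lc_mapE.
Qed.
Definition hom_add g h : contra_hom P Q := ContraHom (hom_add_subproof g h).

Lemma hom_opp_subproof g : is_contra_hom (fun p => - g p).
Proof.
move=> a; have -> : lc_map (fun p => - g p) a =
    lc_map (@cm_act Q) (lc_map (fun p => lc_single (-1) (g p)) a).
  by rewrite lc_map_comp; congr lc_map.
rewrite cm_assocP lc_mul_map.
have -> : (fun p => lc_single (-1) (g p)) = (fun p => - lc_unit R (g p)).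
  by apply/funext => p; rewrite lc_singleE scaleN1r.
by rewrite lc_bindNr -(scaleN1r (lc_bind _ _)) cm_actZ scaleN1r contra_homP lc_mapE.
Qed.
Definition hom_opp g : contra_hom P Q := ContraHom (hom_opp_subproof g).

Fact hom_addA : associative hom_add.
Proof. by move=> g h k; apply: contra_hom_eq => p /=; rewrite addrA. Qed.
Fact hom_addC : commutative hom_add.
Proof. by move=> g h; apply: contra_hom_eq => p /=; rewrite addrC. Qed.
Fact hom_add0 : left_id hom_zero hom_add.
Proof. by move=> g; apply: contra_hom_eq => p /=; rewrite add0r. Qed.
Fact hom_addN : left_inverse hom_zero hom_opp hom_add.
Proof. by move=> g; apply: contra_hom_eq => p /=; rewrite addNr. Qed.
HB.instance Definition _ := GRing.isZmodule.Build (contra_hom P Q)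
  hom_addA hom_addC hom_add0 hom_addN.

End HomGroup.

End Contramodules.

(* The free contramodule with one generator: the set of formal combinations of
   elements of a one-point set is identified with R. *)
Section FreeContramodule.
Variable R : cslRingType.

Definition ring_act (a : lincomb R R) : R := infinite_sum (fun r => a r * r).

Lemma ring_unitP (r : R) : ring_act (lc_unit R r) = r.
Proof. exact: (lc_eval_unit r id). Qed.

Lemma ring_assocP (a : lincomb R (lincomb R R)) :
  ring_act (lc_map ring_act a) = ring_act (lc_mul a).
Proof.
transitivity (lc_eval a ring_act); first exact: (lc_eval_map ring_act a id).
by rewrite lc_mulE; have /esym := lc_eval_bind a id id.
Qed.

Definition ring_contra : contramodule R := Contramodule ring_unitP ring_assocP.

Lemma rmul_contra_subproof (s : R) :
  @is_contra_hom R ring_contra ring_contra (fun t => t * s).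
Proof.
move=> a; transitivity (lc_eval a (fun t => t * s)).
  by rewrite lc_evalMr.
by have /esym := lc_eval_map (fun t => t * s) a id.
Qed.

End FreeContramodule.

Section RestrictionOfScalars.
Variables (R S : cslRingType) (f : {rmorphism R -> S}).
Hypothesis f_cont : continuous f.

Lemma open_preimage (U : set S) : open U -> open (f @^-1` U).
Proof. by move=> oU; apply: open_comp => // x _; exact: f_cont. Qed.

Lemma preimage_subgroup (U : set S) : subgroup U -> subgroup (f @^-1` U).
Proof.
move=> [U0 UB]; split=> [|x y] /=; first by rewrite rmorph0.
by rewrite rmorphB; apply: UB.
Qed.

Lemma preimage_right_ideal (I : set S) : right_ideal I -> right_ideal (f @^-1` I).
Proof.
move=> [gI rI]; split; first exact: preimage_subgroup.
by move=> x r /=; rewrite rmorphM; apply: rI.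
Qed.

Definition preimage_osub (U : open_subgroup S) : open_subgroup R :=
  OpenSubgroup (open_preimage (@osub_open _ U))
    (preimage_subgroup (osub_subgroup U)).

Lemma czero_scalars (X : Type) (r : X -> R) :
  converges_to_zero r -> converges_to_zero (f \o r).
Proof. by move=> rz U; exact: (rz (preimage_osub U)). Qed.

Lemma rmorph_infinite_sum (X : Type) (r : X -> R) : converges_to_zero r ->
  f (infinite_sum r) = infinite_sum (f \o r).
Proof.
move=> rz; apply/esym/infinite_sum_eq => [|I oI iI]; first exact: czero_scalars.
pose V := preimage_osub (ideal_osub oI iI).
have [A AP] := czero_fset V rz; exists A; split=> [x /AP //|].
have := @infinite_sumP _ _ r V A rz AP.
by rewrite /= rmorphB /finite_partial_sum rmorph_sum.
Qed.

Definition lc_scalars (X : Type) (a : lincomb R X) : lincomb S X :=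
  LinComb (czero_scalars (coef_czero a)).

Lemma lc_scalars_eval (X : Type) (a : lincomb R X) (k : X -> R) :
  f (lc_eval a k) = lc_eval (lc_scalars a) (f \o k).
Proof.
rewrite rmorph_infinite_sum; last exact: (czeroMr _ (coef_czero a)).
by apply: eq_infinite_sum => x /=; rewrite rmorphM.
Qed.

Lemma lc_scalars_bind (X Y : Type) (a : lincomb R X) (k : X -> lincomb R Y) :
  lc_scalars (lc_bind a k) = lc_bind (lc_scalars a) (fun x => lc_scalars (k x)).
Proof. by apply: lincomb_eq => y /=; rewrite lc_scalars_eval. Qed.

Lemma lc_scalars_unit (X : Type) (x : X) : lc_scalars (lc_unit R x) = lc_unit S x.
Proof.
by apply: lincomb_eq => y /=; case: asboolP; rewrite ?rmorph1 ?rmorph0.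
Qed.

Lemma lc_scalars_map (X Y : Type) (g : X -> Y) (a : lincomb R X) :
  lc_scalars (lc_map g a) = lc_map g (lc_scalars a).
Proof.
rewrite !lc_mapE lc_scalars_bind; congr lc_bind; apply/funext => x /=.
exact: lc_scalars_unit.
Qed.

Section Object.
Variable Q : contramodule S.

Definition restr_act (a : lincomb R Q) : Q := cm_act (lc_scalars a).

Lemma restr_unitP q : restr_act (lc_unit R q) = q.
Proof. by rewrite /restr_act lc_scalars_unit cm_unitP. Qed.

Lemma restr_assocP (a : lincomb R (lincomb R Q)) :
  restr_act (lc_map restr_act a) = restr_act (lc_mul a).
Proof.
rewrite /restr_act lc_scalars_map -(lc_map_comp (@lc_scalars Q) (@cm_act S Q)).
by rewrite cm_assocP lc_mul_map [in RHS]lc_mulE lc_scalars_bind.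
Qed.

Definition restr : contramodule R := Contramodule restr_unitP restr_assocP.

Lemma separated_restr : separated_contra Q -> separated_contra restr.
Proof.
move=> sQ; apply/seteqP; split=> [q /= Iq|q /= ->].
  have : (\bigcap_(I in [set I : set S | open I /\ right_ideal I]) @contra_mul S Q I) q.
    move=> J /= [oJ rJ].
    have [|a aJ <-] := Iq (f @^-1` J).
      by split; [exact: open_preimage|exact: preimage_right_ideal].
    by exists (lc_scalars a).
  rewrite sQ /= => ->; rewrite -[LHS]cm_act0 -[RHS]cm_act0 /= /restr_act.
  by congr cm_act; apply: lincomb_eq => x /=; rewrite rmorph0.
by move=> I [oI rI]; exists 0 => // x /=; exact: rI.1.1.
Qed.

End Object.

Lemma restr_hom_subproof (Q T : contramodule S) (h : contra_hom Q T) :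
  @is_contra_hom R (restr Q) (restr T) h.
Proof. by move=> a; rewrite /= /restr_act contra_homP lc_scalars_map. Qed.

Definition restr_hom (Q T : contramodule S) (h : contra_hom Q T) :
  contra_hom (restr Q) (restr T) := ContraHom (restr_hom_subproof h).

Lemma ring_hom_subproof :
  @is_contra_hom R (ring_contra R) (restr (ring_contra S)) f.
Proof.
move=> a; rewrite /= /restr_act lc_scalars_map.
transitivity (lc_eval (lc_scalars a) f); first exact: (lc_scalars_eval a id).
by have /esym := lc_eval_map f (lc_scalars a) id.
Qed.

Definition ring_hom : contra_hom (ring_contra R) (restr (ring_contra S)) :=
  ContraHom ring_hom_subproof.

Lemma rmul_hom_subproof (s : S) :
  @is_contra_hom R (restr (ring_contra S)) (restr (ring_contra S)) (fun t => t * s).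
Proof.
move=> a; rewrite /= /restr_act lc_scalars_map; exact: rmul_contra_subproof.
Qed.

Definition rmul_hom (s : S) :
  contra_hom (restr (ring_contra S)) (restr (ring_contra S)) :=
  ContraHom (rmul_hom_subproof s).

Section HomModule.
Variable P : contramodule R.

Definition HomS := contra_hom (restr (ring_contra S)) P.

HB.instance Definition _ := GRing.Zmodule.copy HomS
  (contra_hom (restr (ring_contra S)) P).

(* (s h)(t) = h (t s) *)
Definition HomS_scale (s : S) (h : HomS) : HomS := contra_comp h (rmul_hom s).

Lemma HomS_funD (h : HomS) (s t : S) : h (s + t) = h s + h t.
Proof.
rewrite -contra_homD; congr (h _).
apply/esym; change (lc_eval (lc_scalars (lc_unit R s + lc_unit R t)) id = s + t).
transitivity (lc_eval (lc_unit S s + lc_unit S t) id); last first.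
  by rewrite lc_evalDl !lc_eval_unit.
congr lc_eval; apply: lincomb_eq => x /=.
by rewrite rmorphD; congr (_ + _); case: asboolP; rewrite ?rmorph1 ?rmorph0.
Qed.

Fact HomS_scaleA s t h : HomS_scale s (HomS_scale t h) = HomS_scale (s * t) h.
Proof. by apply: contra_hom_eq => x /=; rewrite mulrA. Qed.
Fact HomS_scale1 : left_id 1 HomS_scale.
Proof. by move=> h; apply: contra_hom_eq => x /=; rewrite mulr1. Qed.
Fact HomS_scaleDr : right_distributive HomS_scale +%R.
Proof. by move=> s g h; apply: contra_hom_eq => x. Qed.
Fact HomS_scaleDl h : {morph HomS_scale ^~ h : s t / s + t}.
Proof.
by move=> s t; apply: contra_hom_eq => x /=; rewrite mulrDr HomS_funD.
Qed.
HB.instance Definition _ := GRing.Zmodule_isLmodule.Build S HomS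
  HomS_scaleA HomS_scale1 HomS_scaleDr HomS_scaleDl.

End HomModule.

End RestrictionOfScalars.

Section Category.

Record category := Category {
  obj :> Type;
  mor : obj -> obj -> Type;
  idm : forall x, mor x x;
  mcomp : forall x y z, mor y z -> mor x y -> mor x z;
  comp1m : forall x y (g : mor x y), mcomp (idm y) g = g;
  compm1 : forall x y (g : mor x y), mcomp g (idm x) = g;
  compmA : forall x y z t (k : mor z t) (h : mor y z) (g : mor x y),
    mcomp k (mcomp h g) = mcomp (mcomp k h) g
}.

Record functor (C D : category) := Functor {
  fobj :> C -> D;
  fmap : forall x y, mor x y -> mor (fobj x) (fobj y);
  fmap1 : forall x, fmap (idm x) = idm (fobj x);
  fmapM : forall x y z (h : mor y z) (g : mor x y),
    fmap (mcomp h g) = mcomp (fmap h) (fmap g)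
}.

(* L is the left adjoint and G the right adjoint. *)
Record adjunction (C D : category) (L : functor C D) (G : functor D C) :=
  Adjunction {
  adj_unit : forall x : C, mor x (G (L x));
  adj_counit : forall y : D, mor (L (G y)) y;
  adj_unit_nat : forall (x x' : C) (g : mor x x'),
    mcomp (fmap G (fmap L g)) (adj_unit x) = mcomp (adj_unit x') g;
  adj_counit_nat : forall (y y' : D) (g : mor y y'),
    mcomp g (adj_counit y) = mcomp (adj_counit y') (fmap L (fmap G g));
  adj_triangle_l : forall x : C,
    mcomp (adj_counit (L x)) (fmap L (adj_unit x)) = idm (L x);
  adj_triangle_r : forall y : D,
    mcomp (fmap G (adj_counit y)) (adj_unit (G y)) = idm (G y)
}.

Definition full_subcategory (C : category) (A : C -> Prop) : category :=
  @Category {x : C | A x} (fun x y => mor (sval x) (sval y))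
    (fun x => idm (sval x)) (fun x y z => @mcomp C (sval x) (sval y) (sval z))
    (fun x y => @comp1m C (sval x) (sval y))
    (fun x y => @compm1 C (sval x) (sval y))
    (fun x y z t => @compmA C (sval x) (sval y) (sval z) (sval t)).

Definition full_subfunctor (C D : category) (A : C -> Prop) (B : D -> Prop)
    (L : functor C D) (AB : forall x, A x -> B (L x)) :
    functor (full_subcategory A) (full_subcategory B) :=
  @Functor (full_subcategory A) (full_subcategory B)
    (fun x => exist B (L (sval x)) (AB _ (svalP x)))
    (fun x y => @fmap C D L (sval x) (sval y)) (fun x => fmap1 L (sval x))
    (fun x y z => @fmapM C D L (sval x) (sval y) (sval z)).

End Category.

Section ContramoduleCategories.

Definition Contra (R : cslRingType) : category.
Proof.
by apply: (@Category (contramodule R) (@contra_hom R) (@contra_id R)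
  (@contra_comp R)) => *; apply: contra_hom_eq.
Defined.

Definition Separ (R : cslRingType) : category :=
  @full_subcategory (Contra R) (@separated_contra R).

Variables (R S : cslRingType) (f : {rmorphism R -> S}).
Hypothesis f_cont : continuous f.

Definition restr_functor : functor (Contra S) (Contra R).
Proof.
by apply: (@Functor (Contra S) (Contra R) (restr f_cont) (restr_hom f_cont)) => *;
  apply: contra_hom_eq.
Defined.

Definition restr_separ : functor (Separ S) (Separ R) :=
  @full_subfunctor (Contra S) (Contra R) (@separated_contra S) (@separated_contra R)
    restr_functor (separated_restr f_cont).

End ContramoduleCategories.

(* A contramodule structure from which the given module structure arises. *)
Record contra_structure (S : cslRingType) (M : lmodType S) := ContraStructure {
  cs_act : lincomb S M -> M;
  cs_unitP : forall m, cs_act (lc_unit S m) = m;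
  cs_assocP : forall a : lincomb S (lincomb S M),
    cs_act (lc_map cs_act a) = cs_act (lc_mul a);
  cs_moduleP : forall c : seq (S * M),
    cs_act (\sum_(sm <- c) lc_single sm.1 sm.2) = \sum_(sm <- c) sm.1 *: sm.2
}.

Definition contra_of (S : cslRingType) (M : lmodType S) (c : contra_structure M) :
    contramodule S :=
  Contramodule (cs_unitP c) (cs_assocP c).

Definition eval_one (R : cslRingType) (P : contramodule R)
  (h : contra_hom (ring_contra R) P) : P := h (1 : R).

Section CoextensionOfScalars.
Variables (R S : cslRingType) (f : {rmorphism R -> S}).
Hypothesis f_cont : continuous f.

Definition HomS_map (P Q : contramodule R) (g : contra_hom P Q)
  (h : HomS f_cont P) : HomS f_cont Q := contra_comp g h.

Variable str : forall P : Separ R, contra_structure (HomS f_cont (sval P)).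
Hypothesis str_sep : forall P : Separ R, separated_contra (contra_of (str P)).
Hypothesis str_nat : forall (P Q : Separ R) (g : contra_hom (sval P) (sval Q)),
  @is_contra_hom S (contra_of (str P)) (contra_of (str Q)) (HomS_map g).

Definition coext_obj (P : Separ R) : Separ S :=
  exist (@separated_contra S) (contra_of (str P)) (str_sep P).

Definition coext_map (P Q : Separ R) (g : contra_hom (sval P) (sval Q)) :
  contra_hom (sval (coext_obj P)) (sval (coext_obj Q)) := ContraHom (str_nat g).

Definition coext_functor : functor (Separ R) (Separ S).
Proof.
by apply: (@Functor (Separ R) (Separ S) coext_obj coext_map) => *;
  apply: contra_hom_eq => h; apply: contra_hom_eq.
Defined.

End CoextensionOfScalars.

(* Main.v *)
(* For [h] in [Hom^R(S, P)] and an open two-sided ideal [I] of [R] whose image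
   generates a right ideal with open closure [J], successive approximation
   (using both countable bases) writes every element of [J] as an infinite sum
   with coefficients in [I], so [h] maps [J] into the closed subgroup
   [contra_mul I] of [P], uniformly in [h].  A separated contramodule over a ring
   with a countable base is complete for these subgroups, so
   [(sum_i s_i h_i)(t) := sum_i h_i (t * s_i)] converges whenever the [s_i] tend
   to zero; contraassociativity is an exchange of two convergent summations.  The
   adjunction unit sends [q] to [t |-> t *: q]. *)
Require Import Defs.
From HB Require Import structures.
From mathcomp Require Import all_boot all_algebra finmap.
From mathcomp Require Import all_classical topology normedtype.

Set Implicit Arguments.
Unset Strict Implicit.
Unset Printing Implicit Defensive.

Import GRing.Theory.

Local Open Scope classical_set_scope.
Local Open Scope ring_scope.

(** * Countable bases and finite sums *)

(** Members of [B] are chosen recursively inside the sets of the countable base [C], so the chain is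
    cofinal although [B] may be uncountable. Prescribing [I0] lets successive approximation start at
    a given ideal. *)
Lemma nbhs0_base_seq (T : topologicalRingType) (B : set_system T) (I0 : set T) :
  countable_nbhs0_base T -> nbhs0_base B -> B I0 ->
  exists I : nat -> set T, [/\ I 0%N = I0, forall n, B (I n),
    forall m n, (m <= n)%N -> I n `<=` I m &
    forall N, nbhs 0 N -> exists n, I n `<=` N].
Proof.
move=> [C cC bC] bB BI0.
have nB K : B K -> nbhs (0 : T) K by move=> BK; rewrite bB; exists K.
have [e einj] : exists e : set T -> nat, {in C &, injective e}.
  exact/countable_injP.
(* The member of [C] with code [n]; the default [setT] keeps every [U n] a neighborhood of zero. *)
pose U n := xget setT [set V | C V /\ e V = n].
have nU n : nbhs (0 : T) (U n).
  rewrite /U; case: xgetP => [V _ [CV _]|_]; last exact: filterT.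
  by rewrite bC; exists V.
have UE V : C V -> U (e V) = V.
  move=> CV; rewrite /U; case: xgetP => [W _ [CW eW]|/(_ V) []//].
  by apply: einj; rewrite ?inE.
have /choice[g gP] : forall nK : nat * set T, exists K',
    B nK.2 -> B K' /\ K' `<=` nK.2 `&` U nK.1.
  move=> [n K] /=; case: (pselect (B K)) => [BK|nBK]; last by exists K.
  have : nbhs (0 : T) (K `&` U n) by apply: filterI => //; exact: nB.
  by rewrite bB => -[K' BK' K'P]; exists K'.
pose I := fix I n := if n is m.+1 then g (m, I m) else I0.
have BI n : B (I n) by elim: n => //= n /(gP (n, I n)) [].
have IS n : I n.+1 `<=` I n by have [_ H] := gP (n, I n) (BI n); move=> x /H [].
exists I; split=> // [m n|N].
  elim: n => [|n IH]; first by rewrite leqn0 => /eqP ->.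
  rewrite leq_eqVlt => /orP[/eqP <- //|/IH]; exact: subset_trans (IS n).
(* The successor appears because it is [I n.+1] that is chosen inside [U n]. *)
rewrite bC => -[V CV VN]; exists (e V).+1; apply: subset_trans VN.
by have [_ H] := gP (e V, I (e V)) (BI (e V)) => x /H []; rewrite /= UE.
Qed.

Lemma open_ideal_setT (R : topologicalRingType) :
  [set I : set R | open I /\ two_sided_ideal I] setT.
Proof. by split; [exact: openT|split; [split|]]. Qed.

Lemma big_fset_subset (V : zmodType) (K : choiceType) (p : K -> V)
    (A B : {fset K}) : (A `<=` B)%fset ->
  \sum_(x <- B) p x = \sum_(x <- A) p x + \sum_(x <- B | x \notin A) p x.
Proof.
move=> /fsubsetP AB; rewrite (bigID (mem A)) /=; congr (_ + _).
rewrite -big_filter; apply: perm_big; apply: uniq_perm.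
- by rewrite filter_uniq ?fset_uniq.
- exact: fset_uniq.
move=> x; rewrite mem_filter.
by apply/andP/idP => [[] //|xA]; split => //; apply: AB.
Qed.

(** Taken over [{classic nat}] to match the finite sets in [has_sum]; along these sets the partial
    sums of a series of differences telescope. *)
Fixpoint initial_segment n : {fset {classic nat}} :=
  if n is m.+1 then ((m : {classic nat}) |` initial_segment m)%fset else fset0.

Lemma in_initial_segment (n m : nat) : ((m : {classic nat}) \in initial_segment n) = (m < n)%N.
Proof.
elim: n => [|n IH] /=; first by rewrite in_fset0.
rewrite in_fset1U IH [in RHS]ltnS [RHS]leq_eqVlt.
have -> // : ((m : {classic nat}) == n) = (m == n :> nat).
  by apply/idP/idP => /eqP ->; exact/eqP.
Qed.

Lemma coef_sum (R : cslRingType) (X Y : Type) (s : seq Y) (a : Y -> lincomb R X) x :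
  (\sum_(y <- s) a y) x = \sum_(y <- s) a y x.
Proof. exact: (big_morph (fun b : lincomb R X => b x)). Qed.

HB.instance Definition _ (R : cslRingType) (P : contramodule R) :=
  GRing.isNmodMorphism.Build (lincomb R P) P (@cm_act R P)
    (conj (@cm_act0 R P) (@cm_actD R P)).

(** * The subgroups [contra_mul I] of a contramodule *)

Section ContraMul.
Variables (R : cslRingType) (P : contramodule R).
Implicit Types (p q : P) (I : set R).

Lemma contra_mulS I I' : I `<=` I' -> @contra_mul R P I `<=` contra_mul I'.
Proof. by move=> II' p [a aI <-]; exists a => // q; apply: II'. Qed.

Lemma contra_mul0 I : subgroup I -> contra_mul I (0 : P).
Proof. by move=> [I0 _]; exists 0. Qed.

Lemma contra_mulB I p q : subgroup I ->
  contra_mul I p -> contra_mul I q -> contra_mul I (p - q).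
Proof.
move=> [_ IB] [a aI <-] [b bI <-]; exists (a - b); first by move=> x; apply: IB.
exact: raddfB.
Qed.

Lemma contra_mulD I p q : subgroup I ->
  contra_mul I p -> contra_mul I q -> contra_mul I (p + q).
Proof.
move=> gI Ip Iq; rewrite -[q]opprK -[- q]sub0r.
by apply: contra_mulB => //; apply: contra_mulB => //; exact: contra_mul0.
Qed.

Lemma contra_mul_sum I (X : Type) (s : seq X) (b : pred X) (p : X -> P) :
  subgroup I -> (forall x, b x -> contra_mul I (p x)) ->
  contra_mul I (\sum_(x <- s | b x) p x).
Proof.
move=> gI Ip; apply: big_ind => //; first exact: contra_mul0.
by move=> *; apply: contra_mulD.
Qed.

Lemma contra_mulZr I r p : two_sided_ideal I ->
  contra_mul I p -> contra_mul I (r *: p).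
Proof.
move=> iI [a aI <-]; exists (r *: a); first by move=> x; apply: iI.2.
exact: cm_actZ.
Qed.

Lemma contra_mulZl I r p : subgroup I -> I r -> contra_mul I (r *: p).
Proof.
move=> gI Ir; exists (lc_single r p) => // x /=.
by case: asboolP => // _; exact: gI.1.
Qed.

(** Separatedness is stated with open right ideals, but each of them contains an open two-sided
    ideal, so testing on the latter is enough. *)
Lemma separated_contra_eq p q : separated_contra P ->
  (forall I, open I -> two_sided_ideal I -> contra_mul I (p - q)) -> p = q.
Proof.
move=> sP Ipq; apply/eqP; rewrite -subr_eq0; apply/eqP.
suff : (\bigcap_(I in [set I : set R | open I /\ right_ideal I]) @contra_mul R P I) (p - q).
  by rewrite sP.
move=> J [oJ rJ].
have [I [oI iI IJ]] := open_ideal_base (open_subgroup_nbhs (OpenSubgroup oJ rJ.1)).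
exact: (contra_mulS IJ (Ipq I oI iI)).
Qed.

Lemma separated_contraI :
  (forall p, (forall I, open I -> two_sided_ideal I -> contra_mul I p) -> p = 0) ->
  separated_contra P.
Proof.
move=> H; apply/seteqP; split=> [p Ip|p /= ->].
  by apply: H => I oI iI; apply: Ip; split => //; exact: iI.1.
by move=> I [_ rI]; apply: contra_mul0; exact: rI.1.
Qed.

End ContraMul.

(** * Unordered sums in a contramodule *)

(* [P] is regarded as a topological group with the subgroups
   [contra_mul I] as a base of neighborhoods of zero. *)
Section Sums.
Variables (R : cslRingType) (P : contramodule R).

Definition family_czero (X : Type) (p : X -> P) :=
  forall I : set R, open I -> two_sided_ideal I ->
  exists A : {fset {classic X}},
    forall x : {classic X}, x \notin A -> contra_mul I (p x).

(** Off the finite rectangle with sides [A] and [B] every entry is small: the uniformity that allows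
    two summations to be exchanged. *)
Definition jointly_family_czero (X Y : Type) (F : X -> Y -> P) :=
  forall I : set R, open I -> two_sided_ideal I ->
  exists (A : {fset {classic X}}) (B : {fset {classic Y}}),
    (forall (x : {classic X}) y, x \notin A -> contra_mul I (F x y)) /\
    (forall x (y : {classic Y}), y \notin B -> contra_mul I (F x y)).

(** Convergence of the net of finite partial sums, stated with one finite set per ideal: since the
    terms outside [A] are small, enlarging [A] does no harm. *)
Definition has_sum (X : Type) (p : X -> P) (s : P) :=
  forall I : set R, open I -> two_sided_ideal I ->
  exists A : {fset {classic X}},
    (forall x : {classic X}, x \notin A -> contra_mul I (p x)) /\
    contra_mul I (s - \sum_(x <- A) p x).

(** The set [A] need not be the one supplied by [has_sum]: both partial sums are compared with the
    one over the union. *)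
Lemma has_sum_tail (X : Type) (p : X -> P) s I (A : {fset {classic X}}) :
  has_sum p s -> open I -> two_sided_ideal I ->
  (forall x : {classic X}, x \notin A -> contra_mul I (p x)) ->
  contra_mul I (s - \sum_(x <- A) p x).
Proof.
move=> ps oI iI pA; have [B [pB sB]] := ps I oI iI; have gI := iI.1.1.
set a := \sum_(x <- A) _ in pA *; set b := \sum_(x <- B) _ in sB *.
have Ha : contra_mul I (\sum_(x <- (A `|` B)%fset) p x - a).
  rewrite (@big_fset_subset _ {classic X} p _ _ (fsubsetUl A B)) addrAC subrr add0r.
  exact: (@contra_mul_sum _ _ _ {classic X}).
have Hb : contra_mul I (\sum_(x <- (A `|` B)%fset) p x - b).
  rewrite (@big_fset_subset _ {classic X} p _ _ (fsubsetUr A B)) addrAC subrr add0r.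
  exact: (@contra_mul_sum _ _ _ {classic X}).
have -> : s - a = (s - b) - ((\sum_(x <- (A `|` B)%fset) p x - b) -
                             (\sum_(x <- (A `|` B)%fset) p x - a)).
  by rewrite opprB addrA opprB addrACA subrK addrA addrAC addrA subrK addrC.
by apply: contra_mulB => //; apply: contra_mulB.
Qed.

(** The subgroup is closed under sums: [has_sum_tail] with the empty set. *)
Lemma has_sum_in (X : Type) (p : X -> P) s I :
  has_sum p s -> open I -> two_sided_ideal I ->
  (forall x, contra_mul I (p x)) -> contra_mul I s.
Proof.
move=> ps oI iI pI; have := @has_sum_tail X p s I fset0 ps oI iI (fun x _ => pI x).
by rewrite big_seq_fset0 subr0.
Qed.

Lemma has_sum_unique (X : Type) (p : X -> P) s s' : separated_contra P ->
  has_sum p s -> has_sum p s' -> s = s'.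
Proof.
move=> sP ps ps'; apply: separated_contra_eq => // I oI iI.
have [A [pA sA]] := ps I oI iI.
rewrite -[s](subrK (\sum_(x <- A) p x)) -addrA -[_ - s']opprB.
apply: contra_mulB => //; first exact: iI.1.1.
exact: has_sum_tail ps' oI iI pA.
Qed.

Lemma eq_has_sum (X : Type) (p p' : X -> P) s : p =1 p' -> has_sum p s -> has_sum p' s.
Proof. by move=> /funext ->. Qed.

Lemma has_sumD (X : Type) (p p' : X -> P) s s' : has_sum p s -> has_sum p' s' ->
  has_sum (fun x => p x + p' x) (s + s').
Proof.
move=> ps ps' I oI iI; have gI := iI.1.1.
have [A [pA _]] := ps I oI iI; have [B [pB _]] := ps' I oI iI.
have pA' (x : {classic X}) : x \notin (A `|` B)%fset -> contra_mul I (p x).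
  by rewrite in_fsetU negb_or => /andP[xA _]; apply: pA.
have pB' (x : {classic X}) : x \notin (A `|` B)%fset -> contra_mul I (p' x).
  by rewrite in_fsetU negb_or => /andP[_ xB]; apply: pB.
exists (A `|` B)%fset; split=> [x xAB|].
  by apply: contra_mulD => //; [exact: pA'|exact: pB'].
rewrite big_split opprD addrACA.
by apply: contra_mulD => //; apply: has_sum_tail.
Qed.

Lemma has_sumZ (X : Type) (r : R) (p : X -> P) s :
  has_sum p s -> has_sum (fun x => r *: p x) (r *: s).
Proof.
move=> ps I oI iI; have [A [pA sA]] := ps I oI iI; exists A; split=> [x /pA|].
  exact: contra_mulZr.
by rewrite -scaler_sumr -scalerBr; apply: contra_mulZr.
Qed.

Lemma has_sum_single (X : Type) (p : X -> P) x0 :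
  (forall x, x <> x0 -> p x = 0) -> has_sum p (p x0).
Proof.
move=> p0 I oI iI; exists [fset (x0 : {classic X})]%fset; split=> [x|].
  by rewrite in_fset1 => /eqP nx; rewrite p0 //; apply: contra_mul0; exact: iI.1.1.
by rewrite big_seq_fset1 subrr; apply: contra_mul0; exact: iI.1.1.
Qed.

(** This links the algebraic operation to the topology: after the finitely many terms with large
    [a x] are removed, the remaining combination has all coefficients in [I]. *)
Lemma has_sum_act (X : Type) (a : lincomb R X) (k : X -> P) :
  has_sum (fun x => a x *: k x) (cm_act (lc_map k a)).
Proof.
move=> I oI iI; pose U := ideal_osub oI iI.
have [A AI] := czero_fset U (coef_czero a).
exists A; split=> [x xA|]; first by apply: contra_mulZl; [exact: iI.1.1|exact: AI].
exists (lc_map k a - \sum_(x <- A) lc_single (a x) (k x)); last first.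
  by rewrite raddfB raddf_sum.
move=> y /=; rewrite coef_sum.
have cz : converges_to_zero (fun x => if `[< k x = y >] then a x else 0).
  exact: (czero_if _ (coef_czero a)).
have := @infinite_sumP _ _ _ U A cz; rewrite /finite_partial_sum /=.
under [X in _ - X]eq_bigr => x _.
  rewrite (_ : `[< k x = y >] = `[< y = k x >]); last by apply/asboolP/asboolP.
  over.
by apply=> x xA; case: asboolP => [_|_]; [exact: AI|exact: iI.1.1.1].
Qed.

(** Both iterated sums differ from the finite double sum over [A] and [B] by an element of
    [contra_mul I]. *)
Lemma has_sum_exchange (X Y : Type) (F : X -> Y -> P) g h s s' :
  separated_contra P -> jointly_family_czero F ->
  (forall x, has_sum (F x) (g x)) -> (forall y, has_sum (F ^~ y) (h y)) ->
  has_sum g s -> has_sum h s' -> s = s'.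
Proof.
move=> sP Fz Fg Fh gs hs'; apply: separated_contra_eq => // I oI iI.
have [A [B [FA FB]]] := Fz I oI iI; have gI := iI.1.1.
have H (Z T : Type) (G : Z -> T -> P) u v (C : {fset {classic Z}})
    (D : {fset {classic T}}) :
    (forall (x : {classic Z}) y, x \notin C -> contra_mul I (G x y)) ->
    (forall x (y : {classic T}), y \notin D -> contra_mul I (G x y)) ->
    (forall x, has_sum (G x) (u x)) -> has_sum u v ->
    contra_mul I (v - \sum_(x <- C) \sum_(y <- D) G x y).
  move=> GC GD Gu uv.
  rewrite -[v](subrK (\sum_(x <- C) u x)) -addrA; apply: contra_mulD => //.
    apply: has_sum_tail => // x xC.
    by apply: (has_sum_in (Gu x)) => // y; apply: GC.
  rewrite -sumrB; apply: (@contra_mul_sum _ _ _ {classic Z}) => // x _.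
  by apply: has_sum_tail => // y; apply: GD.
rewrite -[s](subrK (\sum_(x <- A) \sum_(y <- B) F x y)) -addrA -[_ - s']opprB.
apply: contra_mulB => //; first exact: (H _ _ F).
rewrite exchange_big; apply: (H _ _ (fun y x => F x y) h) => //.
  by move=> y x; apply: FB.
by move=> y x; apply: FA.
Qed.

(** Completeness of [P]: the [p x] are lifted to formal combinations with small coefficients, which
    are added coefficientwise in the complete ring [R]; [cm_act] of the result is the sum. *)
Lemma has_sum_exists (X : Type) (p : X -> P) : countable_nbhs0_base R ->
  separated_contra P -> family_czero p -> exists s, has_sum p s.
Proof.
move=> cR sP pz.
have [I [_ iI Imono Ibase]] :=
  nbhs0_base_seq cR (@cslring_linear R) (open_ideal_setT R).
(* [a x] represents [p x] with coefficients in every [I n] that allows it. *)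
have /choice[a aP] : forall x, exists a : lincomb R P,
    cm_act a = p x /\ forall n, contra_mul (I n) (p x) -> forall q, I n (a q).
  (* An element of every [contra_mul (I n)] is zero by separatedness and is lifted to [0]. *)
  move=> x; have [pI|/existsNP/cid[n0 npI]] := pselect (forall n, contra_mul (I n) (p x)).
    exists 0; split; last by move=> n _ q; exact: (iI n).2.1.1.1.
    rewrite cm_act0; apply: separated_contra_eq => // K oK iK.
    have [n In] := Ibase _ (open_subgroup_nbhs (ideal_osub oK iK)).
    rewrite sub0r -sub0r; apply: contra_mulB; first exact: iK.1.1.
      by apply: contra_mul0; exact: iK.1.1.
    exact: contra_mulS In _ (pI n).
  pose Q n := ~~ `[< contra_mul (I n) (p x) >].
  have exQ : exists n, Q n by exists n0; apply/asboolPn.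
  (* If the least failing index is [0], nothing is required of the lift. If it is [m.+1], a lift
     with coefficients in [I m] serves all allowed [n], since these are at most [m]. *)
  case: (ex_minnP exQ) => -[|m] /asboolPn mQ minQ.
    exists (lc_unit R (p x)); split; first exact: cm_unitP.
    move=> n pI; exfalso; apply: mQ; exact: contra_mulS (Imono _ _ (leq0n n)) _ pI.
  have [b bI bE] : contra_mul (I m) (p x).
    apply: contrapT => /asboolPn nm; have := minQ _ nm; by rewrite ltnn.
  exists b; split=> // n pI q; apply: (Imono _ m) => //.
  rewrite leqNgt; apply/negP => mn; apply: mQ.
  exact: contra_mulS (Imono _ _ mn) _ pI.
(* Rows outside [A] are small as a whole; the finitely many rows in [A] have finitely many large
   entries each, and these lie in finitely many columns. *)
have az : jointly_czero (fun x q => a x q).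
  move=> K oK iK; have [n In] := Ibase _ (open_subgroup_nbhs (ideal_osub oK iK)).
  have [A pA] := pz _ (iI n).1 (iI n).2.
  have fB : finite_set (\bigcup_(x in [set` A]) [set q | ~ K (a x q)]).
    apply: bigcup_finite => [|x _]; first exact: finite_fset.
    exact: (coef_czero (a x) (ideal_osub oK iK)).
  exists A, (@fset_set {classic P} (\bigcup_(x in [set` A]) [set q | ~ K (a x q)])).
  split=> [x q xA|x q]; first by apply: In; apply: (aP x).2; exact: pA.
  rewrite in_fset_set // => /negP; rewrite inE /= => nB.
  have [xA|xA] := boolP ((x : {classic X}) \in A); last first.
    by apply: In; apply: (aP x).2; exact: pA.
  by apply: contrapT => nK; apply: nB; exists x.
exists (cm_act (LinComb (jointly_czero_sum (jointly_czeroC az)))) => K oK iK.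
have [n In] := Ibase _ (open_subgroup_nbhs (ideal_osub oK iK)).
have [A pA] := pz _ (iI n).1 (iI n).2.
exists A; split=> [x /pA|]; first exact: contra_mulS.
exists (LinComb (jointly_czero_sum (jointly_czeroC az)) - \sum_(x <- A) a x).
  move=> q; apply: In => /=; rewrite coef_sum.
  apply: (@infinite_sumP _ _ _ (ideal_osub (iI n).1 (iI n).2)).
    exact: jointly_czero_l az.
  by move=> x xA; apply: (aP x).2; apply: pA.
rewrite raddfB raddf_sum; congr (_ - _); apply: eq_bigr => x _; exact: (aP x).1.
Qed.

End Sums.

(** * Additivity and continuity of contramodule morphisms *)

Lemma contra_hom_nmod_morphism (R : cslRingType) (P Q : contramodule R)
  (h : contra_hom P Q) : nmod_morphism h.
Proof.
split; last by move=> p q; exact: contra_homD.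
by apply: (addrI (h 0)); rewrite -contra_homD !addr0.
Qed.

HB.instance Definition _ (R : cslRingType) (P Q : contramodule R)
  (h : contra_hom P Q) :=
  GRing.isNmodMorphism.Build P Q h (contra_hom_nmod_morphism h).

Section Homomorphisms.
Variables (R : cslRingType) (P Q : contramodule R) (h : contra_hom P Q).

Lemma contra_homZ r p : h (r *: p) = r *: h p.
Proof. by rewrite [r *: p]/(cm_scale r p) contra_homP lc_map_single. Qed.

(** Each coefficient of [lc_map h a] is an infinite sum of elements of [I], and an open subgroup
    contains such sums. *)
Lemma contra_hom_mul (I : set R) p : open I -> subgroup I ->
  contra_mul I p -> contra_mul I (h p).
Proof.
move=> oI gI [a aI <-]; rewrite contra_homP; exists (lc_map h a) => // q /=.
apply: (@infinite_sum_in _ _ _ (OpenSubgroup oI gI)) => [|x].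
  exact: (czero_if _ (coef_czero a)).
by case: asboolP => _; last exact: gI.1; exact: aI.
Qed.

Lemma has_sum_hom (X : Type) (p : X -> P) s :
  has_sum p s -> has_sum (fun x => h (p x)) (h s).
Proof.
move=> ps I oI iI; have [A [pA sA]] := ps I oI iI; exists A; split=> [x /pA|].
  by apply: contra_hom_mul => //; exact: iI.1.1.
rewrite -raddf_sum -raddfB; apply: contra_hom_mul => //; exact: iI.1.1.
Qed.

End Homomorphisms.

(** * The free contramodule on one generator *)

Section RegularContramodule.
Variable S : cslRingType.

(* The identity; the group structure of the contramodule [ring_contra S] is not
   convertible to that of the ring [S]. *)
Definition of_ring (s : ring_contra S) : S := s.

Lemma of_ring_nmod_morphism : nmod_morphism of_ring.
Proof.
split.
  transitivity (lc_eval (0 : lincomb S S) id) => //.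
  by rewrite -(scale0r (0 : lincomb S S)) lc_evalZl mul0r.
move=> s t; transitivity (lc_eval (lc_unit S s + lc_unit S t) id) => //.
by rewrite lc_evalDl !lc_eval_unit.
Qed.

HB.instance Definition _ :=
  GRing.isNmodMorphism.Build (ring_contra S) S of_ring of_ring_nmod_morphism.

Lemma of_ringZ (s : S) (t : ring_contra S) : of_ring (s *: t) = s * of_ring t.
Proof. exact: (lc_eval_single s t id). Qed.

(** Together with [contra_mul_ringI] this shows that on the regular contramodule the topology of
    [has_sum] is that of the ring. *)
Lemma contra_mul_ring (I : set S) (s : ring_contra S) : open I -> right_ideal I ->
  contra_mul I s -> I (of_ring s).
Proof.
move=> oI rI [a aI <-]; apply: (@infinite_sum_in _ _ _ (OpenSubgroup oI rI.1)).
  exact: (czeroMr _ (coef_czero a)).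
by move=> x; apply: rI.2.
Qed.

Lemma contra_mul_ringI (I : set S) (s : ring_contra S) : subgroup I ->
  I (of_ring s) -> contra_mul I s.
Proof.
move=> gI Is; have := @contra_mulZl S (ring_contra S) I s (1 : S) gI Is.
by rewrite -[_ *: _]/(of_ring (_ *: _)) of_ringZ mulr1.
Qed.

Lemma separated_ring : separated_contra (ring_contra S).
Proof.
apply: separated_contraI => s Is; rewrite -[0]/(of_ring 0) raddf0.
apply: separated_eq => I oI iI; rewrite subr0.
by apply: contra_mul_ring => //; [exact: iI.1|exact: Is].
Qed.

End RegularContramodule.

(** * Restriction of scalars and morphisms out of [S] *)

Section Restriction.
Variables (R S : cslRingType) (f : {rmorphism R -> S}).
Hypothesis f_cont : continuous f.

Lemma lc_scalarsD (X : Type) (a b : lincomb R X) :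
  lc_scalars f_cont (a + b) = lc_scalars f_cont a + lc_scalars f_cont b.
Proof. by apply: lincomb_eq => x /=; rewrite rmorphD. Qed.

Lemma lc_scalars0 (X : Type) : lc_scalars f_cont (0 : lincomb R X) = 0.
Proof. by apply: lincomb_eq => x /=; rewrite rmorph0. Qed.

Section Underlying.
Variable Q : contramodule S.

(** The identity; its additivity has to be proved because the operations of the restriction are
    built from [restr_act]. *)
Definition of_restr (q : restr f_cont Q) : Q := q.

Lemma of_restr_nmod_morphism : nmod_morphism of_restr.
Proof.
split; first by rewrite [LHS]/(cm_act (lc_scalars f_cont 0)) lc_scalars0.
move=> p q; rewrite [LHS]/(cm_act (lc_scalars f_cont (lc_unit R p + lc_unit R q))).
by rewrite lc_scalarsD !lc_scalars_unit.
Qed.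

HB.instance Definition _ :=
  GRing.isNmodMorphism.Build (restr f_cont Q) Q of_restr of_restr_nmod_morphism.

Lemma of_restrZ r q : of_restr (r *: q) = f r *: of_restr q.
Proof.
rewrite [LHS]/(cm_act (lc_scalars f_cont (lc_single r q))).
rewrite [RHS]/(cm_act (lc_single (f r) q)); congr cm_act; apply: lincomb_eq => x /=.
by case: asboolP; rewrite ?rmorph0.
Qed.

(** Restriction can only refine the topology: [contra_mul] of the preimage of [I], formed over [R],
    lies in [contra_mul I], formed over [S]. *)
Lemma of_restr_has_sum (X : Type) (p : X -> restr f_cont Q) s :
  has_sum p s -> has_sum (fun x => of_restr (p x)) (of_restr s).
Proof.
move=> ps I oI iI.
have sub q : contra_mul (f @^-1` I) q -> contra_mul I (of_restr q).
  by move=> [a aI <-]; exists (lc_scalars f_cont a).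
have iI' : two_sided_ideal (f @^-1` I).
  split; first exact: preimage_right_ideal iI.1.
  by move=> r x /=; rewrite rmorphM; exact: iI.2.
have [A [pA sA]] := ps _ (open_preimage f_cont oI) iI'.
exists A; split=> [x /pA /sub //|].
by rewrite -raddf_sum -raddfB; exact: sub.
Qed.

End Underlying.

(** The same map with source the ring [S], so that its additivity refers to the addition of the
    ring. *)
Definition HomS_fun (P : contramodule R) (h : HomS f_cont P) (s : S) : P := h s.

Lemma HomS_nmod_morphism P (h : HomS f_cont P) : nmod_morphism (HomS_fun h).
Proof.
split; last by move=> s t; exact: HomS_funD.
by apply: (addrI (HomS_fun h 0)); rewrite -[LHS](HomS_funD h) !addr0.
Qed.

HB.instance Definition _ P (h : HomS f_cont P) :=
  GRing.isNmodMorphism.Build S P (HomS_fun h) (HomS_nmod_morphism h).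

Lemma HomS_linear P (h : HomS f_cont P) r s : h (f r * s) = r *: h s.
Proof.
rewrite -contra_homZ; congr (h _).
by rewrite -[RHS]/(of_ring (of_restr (r *: (s : restr f_cont (ring_contra S)))))
  of_restrZ of_ringZ.
Qed.

End Restriction.

(** * Successive approximation for a strongly right taut map *)

Section Taut.
Variables (R S : cslRingType) (f : {rmorphism R -> S}).
Hypothesis f_cont : continuous f.
Hypothesis R_countable : countable_nbhs0_base R.
Hypothesis S_countable : countable_nbhs0_base S.
Hypothesis f_taut : strongly_right_taut f.

Let SR := restr f_cont (ring_contra S).
Let of_SR (s : SR) : S := of_ring (of_restr s).

(** Right multiplications are endomorphisms of [SR], so [contra_mul I] is itself a right ideal of
    [S]; it contains [f r = r *: 1] for [r] in [I]. *)
Lemma smallest_right_ideal_sub (I : set R) : open I -> two_sided_ideal I ->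
  smallest (@right_ideal S) (f @` I) `<=` @contra_mul R SR I.
Proof.
move=> oI iI; have gI := iI.1.1; apply: smallest_sub.
  split; [split|].
  - have /= := @contra_mul0 R SR I gI.
    by rewrite -[0 in X in X -> _]/(of_SR 0) /of_SR !raddf0.
  - move=> x y Ix Iy; have := @contra_mulB R SR I x y gI Ix Iy.
    by rewrite -[_ - _ in X in X -> _]/(of_SR (_ - _)) /of_SR !raddfB.
  - by move=> x s; exact: (contra_hom_mul (rmul_hom f_cont s)).
move=> _ [r Ir <-].
have := @contra_mulZl R SR I r (1 : S) gI Ir.
by rewrite -[_ *: _ in X in X -> _]/(of_SR (_ *: _)) /of_SR of_restrZ of_ringZ mulr1.
Qed.

(* An element of the closure is expanded into a series by successive
   approximation: the [n]-th term is in the right ideal generated by [f @` K n]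
   and leaves a remainder in the closure of the next one. *)
Lemma closure_right_ideal_sub (I : set R) :
  (let J := closure (smallest (@right_ideal S) (f @` I)) in
    [/\ open I, two_sided_ideal I, open J & two_sided_ideal J]) ->
  closure (smallest (@right_ideal S) (f @` I)) `<=` @contra_mul R SR I.
Proof.
move=> goodI s0 Js0.
have [K [K0 goodK Kmono Kbase]] := nbhs0_base_seq R_countable f_taut goodI.
have [U [_ iU Umono Ubase]] :=
  nbhs0_base_seq S_countable (@cslring_linear S) (open_ideal_setT S).
pose J n := closure (smallest (@right_ideal S) (f @` K n)).
have /choice[g gP] : forall ns : nat * S, exists s', J ns.1 ns.2 ->
    [/\ J ns.1.+1 s', U ns.1 s' & @contra_mul R SR (K ns.1) (ns.2 - s' : S)].
  move=> [n s] /=; have [Js|] := pselect (J n s); last by exists 0.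
  have [_ _ oJ iJ] := goodK n.+1.
  (* The factor [J n.+1] lets the recursion continue; [U n] forces the remainders to tend to
     zero. *)
  pose V := J n.+1 `&` U n.
  have gV : subgroup V.
    split; first by split; [exact: iJ.1.1.1|exact: (iU n).2.1.1.1].
    by move=> x y [? ?] [? ?]; split; [apply: iJ.1.1.2|apply: (iU n).2.1.1.2].
  have V0 : nbhs (0 : S) V.
    by apply: open_nbhs_nbhs; split; [apply: openI => //; exact: (iU n).1|exact: gV.1].
  have [e [Ie Ve]] := Js _ (nbhs_shift s V0).
  exists (s - e) => _; have [Jse Use] : V (s - e) by rewrite -opprB; apply: subgroupN.
  split=> //; rewrite opprB addrCA subrr addr0.
  by have [oK iK _ _] := goodK n; exact: (smallest_right_ideal_sub oK iK).
pose t := fix t n := if n is m.+1 then g (m, t m) else s0.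
have Jt n : J n (t n).
  elim: n => [|n IH]; first by rewrite /J K0.
  by have [] := gP (n, t n) IH.
have Ut n : U n (t n.+1) by have [] := gP (n, t n) (Jt n).
pose e n : S := t n - t n.+1.
have Ke n : @contra_mul R SR (K n) (e n).
  by have [] := gP (n, t n) (Jt n).
have [s es] : exists s, @has_sum R SR nat e s.
  apply: has_sum_exists => //; first exact: separated_restr (separated_ring S).
  move=> L oL iL; have [n Kn] := Kbase _ (open_subgroup_nbhs (ideal_osub oL iL)).
  exists (initial_segment n) => m; rewrite in_initial_segment -leqNgt => nm.
  by apply: contra_mulS (Ke m); apply: subset_trans Kn; exact: Kmono.
(* The sum was formed in the topology coming from [R]; it is identified in that of [S], where the
   partial sums [s0 - t n] tend to [s0]. *)
have -> : s0 = s.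
  apply: separated_eq => W oW iW.
  have [m Um] := Ubase _ (open_subgroup_nbhs (ideal_osub oW iW)).
  have Wt n : (m < n)%N -> W (t n).
    by case: n => // n mn; apply: Um; apply: (Umono m n mn); exact: Ut.
  have esS := of_restr_has_sum es.
  have We n : (m < n)%N -> W (e n).
    by move=> mn; apply: iW.1.1.2; apply: Wt => //; exact: ltnW.
  have tN n : \sum_(i <- initial_segment n) e i = s0 - t n.
    elim: n => [|n IH] /=; first by rewrite big_seq_fset0 subrr.
    rewrite big_fsetU1 ?in_initial_segment ?ltnn //= IH.
    by rewrite addrC addrA subrK.
  (* The segment has length [m.+1] because [t n] is known to lie in [W] only for [n] above [m]. *)
  have eW (n : {classic nat}) : n \notin initial_segment m.+1 ->
      @contra_mul S (ring_contra S) W (e n).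
    rewrite in_initial_segment -leqNgt => mn.
    by apply: contra_mul_ringI; [exact: iW.1.1|exact: We].
  have /(contra_mul_ring oW iW.1) := has_sum_tail esS oW iW eW.
  rewrite raddfB raddf_sum => Ws.
  have {}Ws : W (of_SR s - (s0 - t m.+1)) by rewrite -tN; exact: Ws.
  rewrite -[s]/(of_SR s) (_ : s0 - of_SR s = t m.+1 - (of_SR s - (s0 - t m.+1))); last first.
    by rewrite opprB addrA [t m.+1 + _]addrCA subrr addr0.
  by apply: iW.1.1.2 => //; exact: Wt.
have [oI iI _ _] := goodI.
apply: (has_sum_in es) => // n; apply: contra_mulS (Ke n).
by rewrite -K0; exact: Kmono.
Qed.

(** * Equicontinuity of the morphisms from [S] to [P] *)

Section Family.
Variable P : contramodule R.

(** Tautness supplies [I'] inside [I] whose closed right ideal is open and, by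
    [closure_right_ideal_sub], contained in [contra_mul I']; contramodule morphisms preserve the
    latter. So [J] does not depend on [h]. *)
Lemma HomS_equicontinuous (I : set R) : open I -> two_sided_ideal I ->
  exists J : set S, [/\ open J, two_sided_ideal J &
    forall (h : HomS f_cont P) s, J s -> contra_mul I (h s)].
Proof.
move=> oI iI; have : nbhs (0 : R) I := open_subgroup_nbhs (ideal_osub oI iI).
rewrite f_taut => -[I' goodI' I'I].
exists (closure (smallest (@right_ideal S) (f @` I'))).
have [oI' iI' oJ iJ] := goodI'; split=> // h s /(closure_right_ideal_sub goodI') Is.
apply: contra_mulS I'I _ _; exact: (contra_hom_mul h oI' iI'.1.1 Is).
Qed.

(** The morphism varies with [x], so one neighborhood [J] must serve all the [k x] at once. *)
Lemma HomS_family_czero (X : Type) (r : X -> S) (k : X -> HomS f_cont P) :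
  converges_to_zero r -> family_czero (fun x => k x (r x)).
Proof.
move=> rz I oI iI; have [J [oJ iJ JI]] := HomS_equicontinuous oI iI.
have [A AJ] := czero_fset (ideal_osub oJ iJ) rz.
by exists A => x /AJ; exact: JI.
Qed.

Lemma HomS_jointly_czero (X Y : Type) (F : X -> Y -> S)
    (k : X -> Y -> HomS f_cont P) :
  jointly_czero F -> jointly_family_czero (fun x y => k x y (F x y)).
Proof.
move=> Fz I oI iI; have [J [oJ iJ JI]] := HomS_equicontinuous oI iI.
have [A [B [AJ BJ]]] := Fz J oJ iJ.
by exists A, B; split=> [x y /AJ|x y /BJ] H; apply: JI.
Qed.

Lemma HomS_infinite_sum (X : Type) (r : X -> S) (h : HomS f_cont P) :
  converges_to_zero r -> has_sum (fun x => h (r x)) (h (infinite_sum r)).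
Proof.
move=> rz I oI iI; have [J [oJ iJ JI]] := HomS_equicontinuous oI iI.
have [A AJ] := czero_fset (ideal_osub oJ iJ) rz.
exists A; split=> [x /AJ|]; first exact: JI.
rewrite -[h _]/(HomS_fun h _).
rewrite -[\sum_(x <- A) _]/(\sum_(x <- A) HomS_fun h (r x)) -raddf_sum -raddfB.
by apply: JI; exact: (@infinite_sumP _ _ _ (ideal_osub oJ iJ)).
Qed.

Hypothesis sP : separated_contra P.

(** * The contramodule structure over [S] *)

Section Action.
Variables (X : Type) (a : lincomb S X) (k : X -> HomS f_cont P).

(** The combination of the [k x] with coefficients [a x], evaluated at [t] by the rule
    [(s h)(t) = h(t s)]. A general family [k] allows associativity to be stated as [coact_bind]. By
    [coact_funP] the default [0] never stands in for a missing sum. *)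
Definition coact_fun (t : S) : P :=
  xget 0 [set s | has_sum (fun x => k x (t * a x)) s].

Lemma coact_funP t : has_sum (fun x => k x (t * a x)) (coact_fun t).
Proof.
rewrite /coact_fun; case: xgetP => [s _ //|none].
have cz : converges_to_zero (fun x => t * a x) := czeroMl _ (coef_czero a).
by have [s /none] := has_sum_exists R_countable sP (HomS_family_czero k cz).
Qed.

Lemma coact_is_contra_hom : @is_contra_hom R SR P coact_fun.
Proof.
move=> c; set b := lc_scalars f_cont c.
(* Summed over [x], linearity extracts the scalar [c z]; summed over [z], the composite of [k x]
   with right multiplication by [a x] commutes with the action. Exchanging the sums gives the
   claim. *)
pose F (z : SR) x := k x (b z * ((z : S) * a x)).
have Fz : jointly_family_czero F.
  apply: (HomS_jointly_czero (fun _ : SR => k)); apply: jointly_czero_lc => z.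
  exact: czeroMl _ (coef_czero a).
have Fg (z : SR) : has_sum (F z) (c z *: coact_fun z).
  by apply: eq_has_sum (has_sumZ (c z) (coact_funP z)) => x; rewrite /F -HomS_linear.
have Fh x : has_sum (F ^~ x) (k x ((cm_act c : S) * a x)).
  have := has_sum_act c (contra_comp (k x) (rmul_hom f_cont (a x))).
  rewrite -contra_homP; apply: eq_has_sum => z; rewrite /F -HomS_linear.
  exact: (congr1 (k x) (esym (mulrA _ _ _))).
apply/esym; apply: (has_sum_exchange sP Fz Fg Fh); first exact: has_sum_act.
exact: coact_funP.
Qed.

Definition coact : HomS f_cont P := ContraHom coact_is_contra_hom.

Lemma coactP t : has_sum (fun x => k x (t * a x)) (coact t).
Proof. exact: coact_funP. Qed.

Lemma coact_eq (h : HomS f_cont P) :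
  (forall t, has_sum (fun x => k x (t * a x)) (h t)) -> coact = h.
Proof. by move=> H; apply: contra_hom_eq => t; apply: has_sum_unique (coactP t) (H t). Qed.

End Action.

(** Associativity in Kleisli form. The row sums are values of [coact (l x) k]; the column sums come
    from continuity of each [k y]. *)
Lemma coact_bind (X Y : Type) (a : lincomb S X) (l : X -> lincomb S Y)
    (k : Y -> HomS f_cont P) :
  coact (lc_bind a l) k = coact a (fun x => coact (l x) k).
Proof.
apply: coact_eq => t.
pose F x y := k y ((t *: a) x * l x y).
have Fz : jointly_family_czero F.
  apply: (HomS_jointly_czero (fun _ : X => k)); apply: jointly_czero_lc => x.
  exact: coef_czero.
have Fg x : has_sum (F x) (coact (l x) k (t * a x)) by exact: coactP.
have Fh y : has_sum (F ^~ y) (k y (t * lc_bind a l y)).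
  rewrite [lc_bind a l y]/(infinite_sum _) -infinite_sumMl; last first.
    exact: czeroMr _ (coef_czero a).
  have cz : converges_to_zero (fun x => (t *: a) x * l x y).
    exact: czeroMr _ (coef_czero (t *: a)).
  have := HomS_infinite_sum (k y) cz.
  by under eq_infinite_sum do rewrite /= -mulrA.
have [s ks] : exists s, has_sum (fun y => k y (t * lc_bind a l y)) s.
  by exists (coact (lc_bind a l) k t); exact: coactP.
by rewrite (has_sum_exchange sP Fz Fg Fh (coactP _ _ t) ks).
Qed.

Lemma coact_single (X : Type) s x (k : X -> HomS f_cont P) :
  coact (lc_single s x) k = s *: k x.
Proof.
apply: coact_eq => t; rewrite [(s *: k x) t]/(k x (t * s)).
have := @has_sum_single R P X (fun y => k y (t * lc_single s x y)) x.
have -> : lc_single s x x = s by rewrite /=; case: asboolP.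
apply=> y nyx /=.
by case: asboolP => // _; rewrite mulr0; exact: (raddf0 (HomS_fun (k y))).
Qed.

Lemma coactD (X : Type) (a b : lincomb S X) (k : X -> HomS f_cont P) :
  coact (a + b) k = coact a k + coact b k.
Proof.
apply: coact_eq => t.
apply: eq_has_sum (has_sumD (coactP a k t) (coactP b k t)) => x /=.
by rewrite mulrDr HomS_funD.
Qed.

Lemma coact0 (X : Type) (k : X -> HomS f_cont P) : coact 0 k = 0.
Proof. by apply: (addrI (coact 0 k)); rewrite -coactD !addr0. Qed.

Lemma coact_map (X Y : Type) (g : X -> Y) (a : lincomb S X) (k : Y -> HomS f_cont P) :
  coact (lc_map g a) k = coact a (k \o g).
Proof.
rewrite lc_mapE coact_bind; congr coact; apply/funext => x /=.
by rewrite coact_single scale1r.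
Qed.

Lemma coact_unitP (h : HomS f_cont P) : coact (lc_unit S h) id = h.
Proof. by rewrite coact_single scale1r. Qed.

Lemma coact_assocP (a : lincomb S (lincomb S (HomS f_cont P))) :
  coact (lc_map (fun b => coact b id) a) id = coact (lc_mul a) id.
Proof. by rewrite coact_map lc_mulE coact_bind. Qed.

Lemma coact_moduleP (c : seq (S * HomS f_cont P)) :
  coact (\sum_(sm <- c) lc_single sm.1 sm.2) id = \sum_(sm <- c) sm.1 *: sm.2.
Proof.
rewrite (big_morph (fun a => coact a id) (fun a b => coactD a b id) (coact0 id)).
by apply: eq_bigr => sm _; rewrite coact_single.
Qed.

Definition coact_structure : contra_structure (HomS f_cont P) :=
  @ContraStructure S (HomS f_cont P) (fun a => coact a id)
    coact_unitP coact_assocP coact_moduleP.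

(** If [h] is a combination with coefficients in the equicontinuity ideal [J], then [h t] is a sum
    of values at points [t * a x] of [J], hence lies in [contra_mul I]. Separatedness of [P]
    concludes. *)
Lemma coact_separated : separated_contra (contra_of coact_structure).
Proof.
(* The zero of the new contramodule is the action on the zero combination; [coact0] identifies it
   with the zero morphism. *)
apply: separated_contraI => h Ih; change (h = coact 0 id :> HomS f_cont P).
rewrite coact0; apply: contra_hom_eq => t; apply: separated_contra_eq => // I oI iI.
rewrite -[hom_zero _ _ t]/(0 : P) subr0; have [J [oJ iJ JI]] := HomS_equicontinuous oI iI.
have [a aJ <-] := Ih J oJ iJ; apply: (has_sum_in (coactP a id t)) => // x.
by apply: JI; apply: iJ.2; exact: aJ.
Qed.

End Family.

Lemma coact_natural (P Q : contramodule R) (sP : separated_contra P)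
    (sQ : separated_contra Q) (g : contra_hom P Q) :
  @is_contra_hom S (contra_of (coact_structure sP)) (contra_of (coact_structure sQ))
    (@HomS_map _ _ _ f_cont _ _ g).
Proof.
move=> a; apply/esym; apply: etrans (coact_map sQ _ _ _) _; apply: coact_eq => t.
exact: (has_sum_hom g (coactP sP a id t)).
Qed.

End Taut.

(** * Unit and counit of the adjunction *)

Section Adjunction.
Variables (R S : cslRingType) (f : {rmorphism R -> S}).
Hypothesis f_cont : continuous f.

Section Orbit.
Variable Q : contramodule S.

(** This is the morphism from the free contramodule that sends the generator [1] to [q]; it respects
    infinite sums by contraassociativity of [Q]. *)
Lemma orbit_is_contra_hom (q : Q) :
  @is_contra_hom S (ring_contra S) Q (fun t => t *: q).
Proof.
move=> a; transitivity (cm_act (lc_single (lc_eval a id) q)) => //.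
have -> : lc_single (lc_eval a id) q = lc_bind a (fun t => lc_single t q).
  rewrite lc_singleE; apply: lincomb_eq => x.
  transitivity (lc_eval a id * lc_unit S q x) => //.
  rewrite -lc_evalMr; congr lc_eval; apply/funext => t /=.
  by case: asboolP; rewrite ?mulr1 ?mulr0.
by rewrite -lc_mul_map -cm_assocP lc_map_comp.
Qed.

Definition orbit_hom (q : Q) : HomS f_cont (restr f_cont Q) :=
  restr_hom f_cont (ContraHom (orbit_is_contra_hom q)).

End Orbit.

Hypothesis R_countable : countable_nbhs0_base R.
Hypothesis S_countable : countable_nbhs0_base S.
Hypothesis f_taut : strongly_right_taut f.

Let str (P : Separ R) : contra_structure (HomS f_cont (sval P)) :=
  coact_structure f_cont R_countable S_countable f_taut (svalP P).

(** At [t] both sides are sums in [Q] of the family [(t * a q) *: q]. *)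
Lemma orbit_hom_is_contra_hom (Q : Separ S) :
  @is_contra_hom S (sval Q) (contra_of (str (restr_separ f_cont Q)))
    (@orbit_hom (sval Q)).
Proof.
move=> a; apply/esym; apply: etrans (coact_map _ _ _ _ _ _ _) _.
apply: contra_hom_eq => t.
have := coactP R_countable S_countable f_taut
  (svalP (restr_separ f_cont Q)) a (@orbit_hom (sval Q)) t.
move=> /of_restr_has_sum /(has_sum_unique (svalP Q)); apply.
have := has_sum_act (t *: a) id; rewrite lc_map_id cm_actZ.
exact: eq_has_sum.
Qed.

(** At [1] the action gives the sum of the [h (f (a h))], and [h (f (a h)) = a h *: h 1] by
    linearity over [R]. *)
Lemma eval_one_is_contra_hom (P : Separ R) :
  @is_contra_hom R (restr f_cont (contra_of (str P))) (sval P)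
    (fun h => eval_one (contra_comp h (ring_hom f_cont))).
Proof.
move=> a; apply: (has_sum_unique (svalP P)) (has_sum_act a _).
have := coactP R_countable S_countable f_taut (svalP P)
  (lc_scalars f_cont a) id (f 1).
by apply: eq_has_sum => h /=; rewrite /eval_one /= rmorph1 mul1r -[f _]mulr1 HomS_linear.
Qed.

End Adjunction.

Theorem proposition10p3 (R S : cslRingType) (f : {rmorphism R -> S})
    (f_cont : continuous f)
    (R_countable : countable_nbhs0_base R)
    (S_countable : countable_nbhs0_base S)
    (f_taut : strongly_right_taut f) :
  exists (str : forall P : Separ R, contra_structure (HomS f_cont (sval P)))
    (str_sep : forall P : Separ R, separated_contra (contra_of (str P)))
    (str_nat : forall (P Q : Separ R) (g : contra_hom (sval P) (sval Q)),
      @is_contra_hom S (contra_of (str P)) (contra_of (str Q)) (HomS_map g))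
    (adj : adjunction (restr_separ f_cont) (coext_functor str_sep str_nat)),
    forall (P : Separ R) (h : HomS f_cont (sval P)),
      (adj_counit adj P : contra_hom _ _) h =
      eval_one (contra_comp h (ring_hom f_cont)).
Proof.
pose str (P : Separ R) : contra_structure (HomS f_cont (sval P)) :=
  coact_structure f_cont R_countable S_countable f_taut (svalP P).
have str_sep P : separated_contra (contra_of (str P)) by exact: coact_separated.
have str_nat (P Q : Separ R) (g : contra_hom (sval P) (sval Q)) :
  @is_contra_hom S (contra_of (str P)) (contra_of (str Q)) (HomS_map g).
  exact: coact_natural.
pose G := coext_functor str_sep str_nat.
pose L := restr_separ f_cont.
pose eta (Q : Separ S) : mor Q (G (L Q)) :=
  ContraHom (orbit_hom_is_contra_hom f_cont R_countable S_countable f_taut (Q := Q)).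
pose eps (P : Separ R) : mor (L (G P)) P :=
  ContraHom (@eval_one_is_contra_hom _ _ _ f_cont R_countable S_countable f_taut P).
have eta_nat (Q Q' : Separ S) (g : mor Q Q') :
    mcomp (Defs.fmap G (Defs.fmap L g)) (eta Q) = mcomp (eta Q') g.
  apply: contra_hom_eq => q; apply: contra_hom_eq => t.
  exact: (contra_homZ (g : contra_hom (sval Q) (sval Q'))).
have eps_nat (P P' : Separ R) (g : mor P P') :
    mcomp g (eps P) = mcomp (eps P') (Defs.fmap L (Defs.fmap G g)).
  exact: contra_hom_eq.
have triangle_l (Q : Separ S) : mcomp (eps (L Q)) (Defs.fmap L (eta Q)) = idm (L Q).
  apply: contra_hom_eq => q.
  by rewrite /= /eval_one /= rmorph1 scale1r.
have triangle_r (P : Separ R) : mcomp (Defs.fmap G (eps P)) (eta (G P)) = idm (G P).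
  apply: contra_hom_eq => h; apply: contra_hom_eq => t.
  (* The composite sends [h] to the map with value [(t *: h) 1 = h (1 * t)] at [t]. *)
  transitivity (coact R_countable S_countable f_taut (svalP P)
    (lc_single t h) id (f 1)) => //.
  rewrite coact_single rmorph1.
  exact: (congr1 h (mul1r t)).
by exists str, str_sep, str_nat,
  (@Adjunction _ _ L G eta eps eta_nat eps_nat triangle_l triangle_r).
Qed.
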